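(* Let $\zeta_{TM}:0\mapsto 01,\ 1\mapsto 10$ be the Thue-Morse substitution. Let $\sigma$ be a primitive aperiodic substitution on a finite alphabet such that the substitution subshift $(X_\sigma,T)$ is a topological factor of $(X_{\zeta_{TM}},T)$. Then $\chi_\sigma^+(\omega)=0$ for Lebesgue almost every $\omega\in[0,1)$, where $\chi_\sigma^+$ is the top Lyapunov exponent of the spectral cocycle of $\sigma$.
   Context: Substitutions. Let $\mathcal{A}$ be a finite alphabet with at least two letters and $\mathcal{A}^+$ the set of finite non-empty words on $\mathcal{A}$. A substitution is a map $\zeta:\mathcal{A}\to\mathcal{A}^+$, extended to words and sequences by concatenation. For a word $w$, $|w|_a$ is the number of occurrences of the letter $a$ in $w$. The substitution matrix is $M_\zeta(a,b)=|\zeta(b)|_a$; $\zeta$ is primitive if some power of $M_\zeta$ has only positive entries. The substitution subshift $X_\zeta$ is the set of $(x_n)_{n\in\mathbb{Z}}\in\mathcal{A}^{\mathbb{Z}}$ such that every finite word $x_i\dots x_{i+k}$ is a subword of $\zeta^n(a)$ for some $a\in\mathcal{A}$, $n\in\mathbb{N}$; $T$ is the left shift. $\zeta$ is aperiodic if $X_\zeta$ contains no shift-periodic sequence. A subshift $(Y,T)$ is a topological factor of $(X,T)$ if there is a continuous onto map $\pi:X\to Y$ with $\pi\circ T=T\circ\pi$. Spectral cocycle. Write $e(x)=e^{2\pi i x}$, let $\mathcal{A}=\{1,\dots,m\}$ and $\zeta(a)=w_1\dots w_{k_a}$. For $\xi\in\mathbb{T}^m=(\mathbb{R}/\mathbb{Z})^m$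 let $\mathscr{C}_\zeta(\xi,1)$ be the $m\times m$ matrix with entries $$\mathscr{C}_\zeta(\xi,1)(a,b)=\sum_{j=1}^{k_a}\delta_{w_j,b}\,e(\xi_{w_1}+\dots+\xi_{w_{j-1}}),$$ where $\delta$ is the Kronecker delta, and let $\mathscr{C}_\zeta(\xi,n)=\mathscr{C}_\zeta((M_\zeta^T)^{n-1}\xi,1)\cdots\mathscr{C}_\zeta(\xi,1)$. With $\vec 1=(1,\dots,1)^T$, the pointwise top Lyapunov exponent is $$\chi_\zeta^+(\omega)=\limsup_{n\to\infty}\frac1n\log\|\mathscr{C}_\zeta(\omega\vec 1,n)\|,\qquad \omega\in[0,1).$$ *)

(* Defs.v *)
From HB Require Import structures.
From mathcomp Require Import all_boot all_order all_algebra.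
From mathcomp Require Import all_classical all_reals all_analysis.
From mathcomp Require Import complex.
Set Implicit Arguments.
Unset Strict Implicit.
Unset Printing Implicit Defensive.
Import Order.TTheory GRing.Theory Num.Theory.
Import numFieldNormedType.Exports.
Local Open Scope classical_set_scope.
Local Open Scope ring_scope.

(* The alphabet {1, ..., m} is rendered as 'I_m = {0, ..., m-1}. *)

Record substitution (m : nat) := Substitution {
  subst_fun :> 'I_m -> seq 'I_m;
  subst_nonempty : forall a, subst_fun a != [::] }.

Definition subst_ext m (zeta : substitution m) (w : seq 'I_m) : seq 'I_m :=
  flatten [seq zeta a | a <- w].

Definition subst_mx m (zeta : substitution m) : 'M[nat]_m :=
  \matrix_(a, b) count_mem a (zeta b).

Definition primitive m (zeta : substitution m) : Prop :=
  exists2 n : nat, (0 < n)%N &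
    forall a b, (0 < (subst_mx zeta ^+ n) a b)%N.

(* Two-sided sequences, with the product of the discrete topologies. *)
Notation fullshift m :=
  (prod_topology (fun _ : int => discrete_topology 'I_m)).

Definition shift_map m (x : fullshift m) : fullshift m := fun i => x (i + 1).

Definition window m (x : fullshift m) (i : int) (k : nat) : seq 'I_m :=
  [seq x (i + j%:Z) | j <- iota 0 k.+1].

Definition subshift m (zeta : substitution m) : set (fullshift m) :=
  [set x | forall (i : int) (k : nat), exists (a : 'I_m) (n : nat),
     infix (window x i k) (iter n (subst_ext zeta) [:: a])].

Definition aperiodic m (zeta : substitution m) : Prop :=
  ~ exists x, subshift zeta x /\
      exists2 p : nat, (0 < p)%N & iter p (@shift_map m) x = x.

(* pi is given on the whole full shift, but only its restriction to X matters:
   {within X, continuous pi} is continuity for the subspace topology of X. *)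
Definition topological_factor m n
    (Y : set (fullshift n)) (X : set (fullshift m)) : Prop :=
  exists pi : fullshift m -> fullshift n,
    [/\ {within X, continuous pi}, pi @` X = Y &
        forall x, X x -> pi (shift_map x) = shift_map (pi x)].

Section SpectralCocycle.
Variables (R : realType) (m : nat) (zeta : substitution m).

Definition e2pi (x : R) : R[i] :=
  Complex (cos (2 * pi * x)) (sin (2 * pi * x)).

(* The torus variable is represented by a lift to R^m; since e2pi is 1-periodic
   and subst_mx has integer entries, the matrices depend only on the class
   of xi modulo Z^m. *)
Definition cocycle1 (xi : 'cV[R]_m) : 'M[R[i]]_m :=
  \matrix_(a, b) \sum_(j < size (zeta a))
    (nth a (zeta a) j == b)%:R * e2pi (\sum_(c <- take j (zeta a)) xi c 0).

Definition torus_map (xi : 'cV[R]_m) : 'cV[R]_m :=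
  map_mx (fun k : nat => k%:R) (subst_mx zeta)^T *m xi.

Fixpoint cocycle (xi : 'cV[R]_m) (n : nat) : 'M[R[i]]_m :=
  if n is n'.+1 then cocycle1 (iter n' torus_map xi) *m cocycle xi n'
  else 1%:M.

(* mx_norm takes its (nonnegative real) values in the complex field. Any other
   norm gives the same exponent, as all norms on matrices are equivalent.
   lne is the extended logarithm, with lne 0 = -oo. *)
Definition lyapunov (omega : R) : \bar R :=
  limn_esup (fun n : nat => ((n%:R)^-1)%:E *
    lne (complex.Re (mx_norm (cocycle (const_mx omega) n)))%:E)%E.

End SpectralCocycle.

Definition thue_morse_fun (a : 'I_2) : seq 'I_2 :=
  if a == 0 then [:: 0; 1] else [:: 1; 0].

Fact thue_morse_nonempty a : thue_morse_fun a != [::].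
Proof. by rewrite /thue_morse_fun; case: ifP. Qed.

Definition thue_morse : substitution 2 := Substitution thue_morse_nonempty.

(* Main.v *)
Require Import Defs.
From mathcomp Require Import all_boot all_order all_algebra.
From mathcomp Require Import all_classical all_reals all_analysis.
From mathcomp Require Import measurable_realfun complex ring lra zify.
Import Order.TTheory GRing.Theory Num.Theory.
Import numFieldNormedType.Exports.
Import Normc.
Set Implicit Arguments.
Unset Strict Implicit.
Unset Printing Implicit Defensive.
Local Open Scope classical_set_scope.
Local Open Scope ring_scope.

(** Write [e(x)] for [e2pi x]. The entry [(a, b)] of the [n]-th cocycle matrix at
    [(x, ..., x)] is the sum of [e(j x)] over the positions [j] of the letter [b]
    in the word [sigma^n(a)] ([cocycle_letter_sum]), so the exponent compares
    the size of such sums with [n].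

    Lower bound. Summing over [b] leaves a geometric sum, of modulus
    [|1 - e(N x)| / |1 - e(x)|] where [N] is the length of [sigma^n(a)]
    ([sum_letter_sum]). By a Borel-Cantelli argument it is not exponentially
    small for almost every [x] ([ae_chord_lower]).

    Upper bound. A factor map is a sliding block code ([sliding_block]), so the
    positions of [b] in [sigma^n(a)] are those where a fixed function of
    finitely many consecutive letters of the Thue-Morse sequence [t] takes the
    value [true], along some interval of integers ([factor_words]). As the
    length of [sigma^n(a)] is at most exponential in [n], it suffices that sums
    [sum_j f(j) e(j x)] over [N] consecutive integers are [O(N^epsilon)] for
    each function [f] of finite windows of [t] ([local_subexp]). Since
    [t(2 j) = t(j)] and [t(2 j + 1) = 1 - t(j)], adding the terms [2 k] and
    [2 k + 1] gives a sum of the same kind at frequency [2 x], half as long and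
    with windows roughly half as wide. After finitely many steps the windows
    have length two, and four characters remain: the constant, which gives
    geometric sums; [chi = (-1)^t] and its translate, multiplied by [1 - e(x)]
    at each step; and their product, which at each step returns itself and a
    constant. So everything is controlled by the inverses of
    [|1 - e(2^k x)|], as in the lower bound, and by the Riesz products
    [prod_(k < n) |1 - e(2^k x)|].

    The Riesz products grow subexponentially almost everywhere. The function
    [c(x) = |1 - e(x)|] satisfies [c(2 x) = c(x) c(x + 1/2)], so that
    [c(x)^2 / c(2 x)] takes inverse values at [x] and [x + 1/2], the two
    preimages of a point under doubling: up to a coboundary, [log c] is a
    reverse martingale difference. Adding a small [d] to [c] in the coboundary
    makes everything bounded at a small cost in the mean ([alpha_half]), and
    then exponential moments of the Birkhoff sums are estimated on dyadic
    grids with the transfer operator of the doubling map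
    ([orbit_prod_average]). Markov's inequality and Borel-Cantelli conclude
    ([ae_good]). *)

(** * Exponentials and the chord length *)

Section Exponential.
Context {R : realType}.
Implicit Types (x y : R) (n : nat).

Lemma e2piD x y : e2pi (x + y) = e2pi x * e2pi y.
Proof.
rewrite /e2pi mulrDr cosD sinD.
by apply/eqP; rewrite eq_complex /=; apply/andP; split; apply/eqP; ring.
Qed.

Lemma e2pi0 : e2pi (0 : R) = 1.
Proof. by rewrite /e2pi mulr0 cos0 sin0. Qed.

Lemma e2pi1 : e2pi (1 : R) = 1.
Proof. by rewrite /e2pi mulr1 mulr_natl cos2pi sin2pi. Qed.

Lemma e2piMn x n : e2pi (x *+ n) = e2pi x ^+ n.
Proof.
elim: n => [|n IH]; first by rewrite mulr0n e2pi0 expr0.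
by rewrite mulrS e2piD IH exprS.
Qed.

Lemma e2pi_nat n : e2pi (n%:R : R) = 1.
Proof. by rewrite e2piMn e2pi1 expr1n. Qed.

Lemma normc_e2pi x : normc (e2pi x) = 1.
Proof. by rewrite /e2pi /normc cos2Dsin2 sqrtr1. Qed.

Lemma e2pi_half : e2pi (2^-1 : R) = -1.
Proof.
rewrite /e2pi mulrAC divff ?pnatr_eq0// mul1r cospi sinpi.
by apply/eqP; rewrite eq_complex /= oppr0 !eqxx.
Qed.

Lemma normc_ge0 (z : R[i]) : 0 <= normc z.
Proof. by case: z => a b; rewrite /normc sqrtr_ge0. Qed.

Lemma sqr_normcE (a b : R) : normc (Complex a b) ^+ 2 = a ^+ 2 + b ^+ 2.
Proof. by rewrite /normc sqr_sqrtr ?addr_ge0 ?sqr_ge0. Qed.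

Lemma normc_zero : normc (0 : R[i]) = 0. Proof. exact: normc0. Qed.

Lemma normc_one : normc (1 : R[i]) = 1. Proof. exact: normc1. Qed.

Lemma normc_sum (I : Type) (r : seq I) (P : pred I) (F : I -> R[i]) :
  normc (\sum_(i <- r | P i) F i) <= \sum_(i <- r | P i) normc (F i).
Proof.
elim/big_ind2 : _ => [|z a w b za wb|//]; first by rewrite normc0.
by rewrite (le_trans (le_normcD _ _))// lerD.
Qed.

Definition chord x : R := normc (1 - e2pi x).

Lemma chord_ge0 x : 0 <= chord x. Proof. exact: normc_ge0. Qed.

Lemma chordE x : chord x = 2 * `|sin (pi * x)|.
Proof.
apply/eqP; rewrite -(@eqrXn2 _ 2) ?chord_ge0// ?mulr_ge0//.
rewrite exprMn real_normK ?num_real// sqr_normcE /=.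
have -> : 2 * pi * x = (pi * x) *+ 2 :> R by rewrite mulr2n; ring.
rewrite cos_mulr2n sin_mulr2n sin2cos2.
have := cos2Dsin2 (pi * x); set c := cos _; set s := sin _ => cs.
have s2 : s ^+ 2 = 1 - c ^+ 2 by rewrite -cs; ring.
by apply/eqP; rewrite sub0r sqrrN exprMn_n exprMn s2; ring.
Qed.

(** The factorization [1 - z ^+ 2 = (1 - z) * (1 + z)]; by it the logarithm of the
    chord is an eigenfunction of the transfer operator of the doubling map. *)
Lemma chord_double x : chord (2 * x) = chord x * chord (x + 2^-1).
Proof.
rewrite /chord -normcM e2piD e2pi_half mulrN1 opprK mulr_natl e2piMn.
by congr normc; ring.
Qed.

Lemma chord_le2 x : chord x <= 2.
Proof. by rewrite chordE -[leRHS]mulr1 ler_pM2l// sin_max. Qed.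

Lemma chordDn x n : chord (x + n%:R) = chord x.
Proof. by rewrite /chord e2piD e2pi_nat mulr1. Qed.

Lemma chordN x : chord (- x) = chord x.
Proof. by rewrite !chordE mulrN sinN normrN. Qed.

Lemma sin_mvt x : 0 <= x -> exists2 c, 0 <= c <= x & sin x = cos c * x.
Proof.
move=> x0; have [|c] := @MVT_segment R sin cos 0 x x0 (fun y _ => is_derive_sin y).
  by apply: continuous_subspaceT => y; exact: continuous_sin.
by rewrite in_itv /= sin0 !subr0 => cx ->; exists c.
Qed.

Lemma chord_le x : chord x <= 2 * pi * `|x|.
Proof.
wlog x0 : x / 0 <= x => [H|].
  by have [/H//|/ltW x0] := leP 0 x; rewrite -chordN -normrN H// oppr_ge0.
have px : 0 <= pi * x by rewrite mulr_ge0// pi_ge0.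
rewrite chordE (ger0_norm x0) -mulrA ler_pM2l//.
have [c _ ->] := sin_mvt px.
by rewrite normrM (ger0_norm px) ler_piMl// cos_max.
Qed.

Lemma chord_lip x y : chord x <= chord y + 2 * pi * `|x - y|.
Proof.
rewrite (le_trans _ (lerD (lexx _) (chord_le _)))//.
have -> : chord (x - y) = normc (e2pi y - e2pi x).
  rewrite /chord -[LHS]mul1r -(normc_e2pi y) -normcM mulrBr mulr1 -e2piD.
  by rewrite [y + _]addrC subrK.
by apply: le_trans (le_normcD _ _); rewrite addrA subrK.
Qed.

(** On [0, 1] the sine dominates [cos 1] times its argument by the mean value
    theorem; from [1] to [pi / 2] it is at least [sin 1]. *)
Lemma chord_ge_near0 :
  exists2 k : R, 0 < k & forall x, `|x| <= 2^-1 -> k * `|x| <= chord x.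
Proof.
have s1 : 0 < sin 1 :> R by apply: sin2_gt0; lra.
have c1 : 0 < cos 1 :> R by exact: cos1_gt0.
exists (Num.min (cos 1) (sin 1 / 2)) => [|x].
  by rewrite lt_min c1 divr_gt0.
wlog x0 : x / 0 <= x => [H|].
  have [/H//|/ltW x0] := leP 0 x; rewrite -chordN -normrN => ?.
  by rewrite H// oppr_ge0.
rewrite (ger0_norm x0) chordE => x2.
have p2 := @pi_ge2 R; have p4 : pi / 2 < 2 :> R := @pihalf_lt2 R.
set k := Num.min _ _.
have k0 : 0 <= k by rewrite le_min !ltW// divr_gt0.
have px : 0 <= pi * x by rewrite mulr_ge0// pi_ge0.
have xp : x <= pi * x by rewrite ler_peMl//; lra.
have pxpi : pi * x <= pi / 2 by rewrite ler_pM2l// ?pi_gt0.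
suff H : k * (pi * x) <= `|sin (pi * x)|.
  apply: le_trans (_ : k * (pi * x) <= _); first by rewrite ler_wpM2l.
  by apply: (le_trans H); rewrite ler_peMl// ler1n.
have [p1|p1] := leP (pi * x) 1.
  have [c /andP[c0 cx] ->] := sin_mvt px.
  have cc : cos 1 <= cos c.
    by rewrite leNgt ltr_cos ?in_itv /= -?leNgt;
      [lra|apply/andP; split; lra|apply/andP; split; lra].
  have c0' : 0 <= cos c by apply: le_trans cc; exact: ltW.
  rewrite ger0_norm ?mulr_ge0 ?pi_ge0// ler_wpM2r//.
  by rewrite (le_trans _ cc)// ge_min lexx.
have ss : sin 1 <= sin (pi * x).
  by rewrite leNgt ltr_sin ?in_itv /= -?leNgt;
    [lra|apply/andP; split; lra|apply/andP; split; lra].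
rewrite ger0_norm; last by lra.
apply: le_trans ss.
apply: (@le_trans _ _ (sin 1 / 2 * (pi * x))).
  by rewrite ler_wpM2r// ge_min lexx orbT.
rewrite -mulrA ler_piMr// ?ltW//; lra.
Qed.

Lemma chord_ge :
  exists2 k : R, 0 < k & forall y, 0 <= y ->
    exists2 n : nat, n%:R <= y + 2^-1 & k * `|y - n%:R| <= chord y.
Proof.
have [k k0 H] := chord_ge_near0; exists k => // y y0.
have y20 : 0 <= y + 2^-1 by rewrite addr_ge0.
have /andP[n1 n2] := truncn_itv y20.
exists (Num.truncn (y + 2^-1)) => //.
set n := Num.truncn _ in n1 n2 *.
have -> : chord y = chord (y - n%:R) by rewrite -(chordDn (y - _) n) subrK.
apply: H; rewrite ler_norml; move: n2; rewrite -[n.+1]addn1 natrD => n2.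
by apply/andP; split; lra.
Qed.

End Exponential.

(** * The cocycle as an exponential sum over substituted words *)

Section Words.
Context {m : nat} (sigma : substitution m).
Implicit Types (a b c : 'I_m) (u v w : seq 'I_m) (n : nat).

Local Notation image n w := (iter n (subst_ext sigma) w).

Lemma image_cat n u v : image n (u ++ v) = image n u ++ image n v.
Proof.
elim: n => //= n ->.
by rewrite /subst_ext map_cat flatten_cat.
Qed.

Lemma image_flatten n w : image n w = flatten [seq image n [:: c] | c <- w].
Proof.
elim: w => [|c w IH] /=; first by elim: n => //= n ->.
by rewrite -cat1s image_cat IH.
Qed.

Lemma imageS n a : image n.+1 [:: a] = image n (sigma a).
Proof. by rewrite iterSr /= /subst_ext /= cats0. Qed.

Lemma size_image_gt0 n w : w != [::] -> (0 < size (image n w))%N.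
Proof.
move=> w0; elim: n => [|n] /=; first by rewrite lt0n size_eq0.
case: (image n w) => // c s _.
rewrite /subst_ext /= size_cat addn_gt0 lt0n size_eq0.
by rewrite subst_nonempty.
Qed.

End Words.

Section CocycleSum.
Context {R : realType} {m : nat} (sigma : substitution m).
Implicit Types (a b c : 'I_m) (u v w : seq 'I_m) (n : nat) (x : R).

Local Notation image n w := (iter n (subst_ext sigma) w).

Lemma sum_count (V : nzSemiRingType) w (f : 'I_m -> V) :
  \sum_(c <- w) f c = \sum_c (count_mem c w)%:R * f c.
Proof.
elim: w => [|d w IH]; first by rewrite big_nil big1// => c _; rewrite mul0r.
rewrite big_cons IH (bigD1 d)//= [RHS](bigD1 d)//= eqxx natrD mulrDl mul1r addrA.
by congr (_ + _); apply: eq_bigr => c /negPf cd; rewrite eq_sym cd.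
Qed.

Definition letter_sum x b w : R[i] :=
  \sum_(0 <= j < size w) (nth b w j == b)%:R * e2pi (x *+ j).

Lemma letter_sum_cat x b u v :
  letter_sum x b (u ++ v) =
  letter_sum x b u + e2pi (x *+ size u) * letter_sum x b v.
Proof.
rewrite /letter_sum size_cat (big_cat_nat (n := size u))//= ?leq_addr//.
congr (_ + _).
  by apply: eq_big_nat => j /andP[_ ju]; rewrite nth_cat ju.
rewrite -{1}[size u]add0n big_addn addKn mulr_sumr.
apply: eq_big_nat => j _; rewrite nth_cat ltnNge leq_addl /= addnK.
by rewrite mulrnDr e2piD mulrA mulrC.
Qed.

Lemma letter_sum_flatten x b (F : 'I_m -> seq 'I_m) a w :
  letter_sum x b (flatten [seq F c | c <- w]) =
  \sum_(j < size w) e2pi (\sum_(c <- take j w) x *+ size (F c)) *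
    letter_sum x b (F (nth a w j)).
Proof.
elim/last_ind: w => [|w c IH]; first by rewrite big_ord0 /letter_sum big_geq.
rewrite -cats1 map_cat flatten_cat letter_sum_cat IH /= cats0.
rewrite size_cat addn1 big_ord_recr /= take_size_cat// nth_cat ltnn subnn /=.
congr (_ + _ * _).
  by apply: eq_bigr => j _; rewrite nth_cat ltn_ord takel_cat// ltnW.
congr e2pi; rewrite size_flatten /shape -map_comp sumnE big_map.
by rewrite -sumrMnr.
Qed.

Lemma iter_torus_map x n a :
  iter n (torus_map sigma) (const_mx x) a 0 = x *+ size (image n [:: a]).
Proof.
elim: n a => [|n IH] a; first by rewrite mxE.
rewrite imageS image_flatten size_flatten /shape -map_comp sumnE big_map.
rewrite -sumrMnr sum_count iterS mxE.
by apply: eq_bigr => c _; rewrite !mxE IH.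
Qed.

(** The phases in the cocycle are the positions of the letters, because the
    torus map sends the constant vector to the vector of lengths. *)
Lemma cocycle_letter_sum x n a b :
  cocycle sigma (const_mx x) n a b = letter_sum x b (image n [:: a]).
Proof.
elim: n a => [|n IH] a.
  by rewrite /letter_sum /= big_nat1 mxE mulr0n e2pi0 mulr1.
rewrite imageS image_flatten (letter_sum_flatten _ _ _ a) /= mxE.
under [LHS]eq_bigr do rewrite /cocycle1 mxE mulr_suml.
rewrite exchange_big /=; apply: eq_bigr => j _.
rewrite (bigD1 (nth a (sigma a) j))//= eqxx mul1r IH [X in _ + X]big1.
  rewrite addr0; congr (e2pi _ * _).
  by apply: eq_bigr => c _; rewrite iter_torus_map.
by move=> c /negPf; rewrite eq_sym => ->; rewrite !mul0r.
Qed.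

(** Exactly one letter sits at each position, so the sum over the letters is
    geometric. *)
Lemma sum_letter_sum x w :
  (1 - e2pi x) * (\sum_b letter_sum x b w) = 1 - e2pi (x *+ size w).
Proof.
rewrite /letter_sum exchange_big /= e2piMn -opprB -[in RHS]opprB subrX1.
rewrite mulNr big_mkord; congr (- (_ * _)).
case: w => [|d w]; first by rewrite !big_ord0.
apply: eq_bigr => j _; rewrite -mulr_suml e2piMn.
rewrite (bigD1 (nth d (d :: w) j))//= (set_nth_default d)// eqxx big1 ?addr0 ?mul1r//.
by move=> c /negPf; rewrite eq_sym (set_nth_default d)// => ->.
Qed.

End CocycleSum.

(** * The one-sided Thue-Morse sequence *)

(** The first argument is fuel: halving [n] times exhausts the binary digits of
    [n]. *)
Fixpoint bit_parity (k n : nat) : bool :=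
  if k is k'.+1 then odd n (+) bit_parity k' n./2 else false.

Definition tm (n : nat) : bool := bit_parity n n.

Lemma bit_parity_tm k n : (n <= k)%N -> bit_parity k n = tm n.
Proof.
have p0 j : bit_parity j 0 = false by elim: j.
rewrite /tm; have [l] := ubnP n; elim: l n k => // l IH [|n] [|k] //= nl nk.
by congr (_ (+) _); rewrite [LHS]IH ?[RHS]IH//; lia.
Qed.

Lemma tmE n : tm n = odd n (+) tm n./2.
Proof. by case: n => // n; rewrite -[in RHS](@bit_parity_tm n)//; lia. Qed.

Lemma tm_double n : tm n.*2 = tm n.
Proof. by rewrite tmE odd_double doubleK. Qed.

Lemma tm_doubleS n : tm n.*2.+1 = ~~ tm n.
Proof. by rewrite tmE /= odd_double uphalf_double. Qed.

(** Binary digits do not interact when the low part does not overflow. *)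
Lemma tm_split n p i : (i < 2 ^ n)%N -> tm (2 ^ n * p + i) = tm p (+) tm i.
Proof.
elim: n i => [|n IH] i.
  by rewrite ltnS leqn0 => /eqP ->; rewrite addn0 mul1n addbF.
rewrite expnS => ilt; rewrite tmE (tmE i) addbCA -IH; last by lia.
rewrite -mulnA mul2n; set q := (2 ^ n * p)%N.
by congr (_ (+) tm _); [rewrite oddD odd_double|lia].
Qed.

Definition tm_letter (n : nat) : 'I_2 := (tm n)%:R.

Definition tm_word (p n : nat) : seq 'I_2 := [seq tm_letter j | j <- iota p n].

Lemma subst_tm_word p n :
  subst_ext thue_morse (tm_word p n) = tm_word p.*2 n.*2.
Proof.
elim: n p => [//|n IH] p.
rewrite (_ : subst_ext _ (tm_word p n.+1) =
  thue_morse_fun (tm_letter p) ++ subst_ext thue_morse (tm_word p.+1 n))//.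
rewrite IH /tm_word !doubleS /= /tm_letter tm_double tm_doubleS.
by rewrite /thue_morse_fun; case: (tm p).
Qed.

Lemma image_tm_word k p n :
  iter k (subst_ext thue_morse) (tm_word p n) = tm_word (2 ^ k * p) (2 ^ k * n).
Proof.
elim: k => [|k IH]; first by rewrite !mul1n.
by rewrite iterS IH subst_tm_word !expnS -!mul2n !mulnA.
Qed.

(** With [infix_tm_word], all words of the Thue-Morse language are read on the one
    sequence [tm], at some position. *)
Lemma image_tm_letter k (a : 'I_2) :
  iter k (subst_ext thue_morse) [:: a] = tm_word (2 ^ k * a) (2 ^ k).
Proof.
transitivity (iter k (subst_ext thue_morse) (tm_word a 1)); last first.
  by rewrite image_tm_word muln1.
congr (iter _ _ [:: _]).
by apply/val_inj; case: a => [[|[|]]].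
Qed.

Lemma infix_tm_word w p n : infix w (tm_word p n) ->
  exists q, w = tm_word q (size w).
Proof.
case/infixP => u [v E].
have : w = take (size w) (drop (size u) (tm_word p n)).
  by rewrite E drop_size_cat// take_size_cat.
rewrite /tm_word -map_drop drop_iota -map_take take_iota => Ew.
exists (p + size u)%N; rewrite [LHS]Ew; congr map; congr iota.
move/(congr1 size): E; rewrite size_map size_iota !size_cat; lia.
Qed.

(** * Factors of the Thue-Morse subshift *)

Lemma windowP m (x : fullshift m) (i : int) k (w : seq 'I_m) :
  window x i k = w -> forall j d, (j <= k)%N -> x (i + j%:Z) = nth d w j.
Proof. by move=> <- j d jk; rewrite (nth_map 0%N) ?size_iota// nth_iota. Qed.

Lemma subshift_tm_word (x : fullshift 2) : subshift thue_morse x ->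
  forall (i : int) k, exists p, forall j, (j <= k)%N ->
    x (i + j%:Z) = tm_letter (p + j).
Proof.
move=> Xx i k; have [a [n]] := Xx i k.
rewrite image_tm_letter => /infix_tm_word[p E]; exists p => j jk.
rewrite (windowP E ord0 jk) size_map size_iota (nth_map 0%N) ?size_iota//.
by rewrite nth_iota.
Qed.

(** As [tm 5 = tm 6 = false], the images of level [2 n] of the letter [0] end and
    start at the position [6 * 4 ^ n]. Around these positions one thus sees
    larger and larger windows of a single two-sided sequence. *)
Lemma tm_stable n (i : int) : (`|i| < 2 ^ n.*2)%N ->
  tm (absz ((6 * 2 ^ n.+1.*2)%N%:Z + i)) = tm (absz ((6 * 2 ^ n.*2)%N%:Z + i)).
Proof.
rewrite doubleS !expnS; case: i => [i|k] /=.
  move=> ilt; set N := (2 ^ n.*2)%N in ilt *.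
  have -> : (6 * (2 * (2 * N)) + i = N * 24 + i)%N by lia.
  have -> : (6 * N + i = N * 6 + i)%N by lia.
  by rewrite /N !tm_split.
rewrite NegzE => kN; set N := (2 ^ n.*2)%N in kN *.
have -> : absz ((6 * (2 * (2 * N)))%N%:Z - (k.+1)%:Z) = (N * 23 + (N - k.+1))%N by lia.
have -> : absz ((6 * N)%N%:Z - (k.+1)%:Z) = (N * 5 + (N - k.+1))%N by lia.
by rewrite /N !tm_split//; lia.
Qed.

(** Through the factor map, the source of points of the other subshift. *)
Lemma tm_subshift_nonempty : exists x, subshift thue_morse x.
Proof.
pose N n := (6 * 2 ^ n.*2)%N.
pose x : fullshift 2 := fun i => tm_letter (absz ((N `|i|%N)%:Z + i)).
have xE n (i : int) : (`|i| <= n)%N -> x i = tm_letter (absz ((N n)%:Z + i)).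
  elim: n => [|n IH]; first by rewrite leqn0 => /eqP i0; rewrite /x i0.
  rewrite leq_eqVlt => /predU1P[<-//|]; rewrite ltnS => in_.
  rewrite IH// /tm_letter /N -tm_stable//.
  rewrite (leq_ltn_trans in_)// (leq_trans (ltn_expl n (isT : 1 < 2)%N))//.
  by rewrite leq_pexp2l// -addnn leq_addl.
exists x => i k; pose n := (`|i| + k)%N.
have n2 : (n < 2 ^ n.*2)%N.
  rewrite (leq_trans (ltn_expl n (isT : 1 < 2)%N))//.
  by rewrite leq_pexp2l// -addnn leq_addl.
exists 0, (n.*2 + 3)%N; rewrite image_tm_letter muln0.
have [p pE] : exists p : nat, p%:Z = (N n)%:Z + i.
  by exists (absz ((N n)%:Z + i)); rewrite /N /n in n2 *; lia.
have -> : window x i k = tm_word p k.+1.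
  rewrite /window /tm_word -[p in RHS]addn0 iotaDl -map_comp.
  apply/eq_in_map => j; rewrite mem_iota /= => jk.
  rewrite (xE n) ?addrA -?pE//.
  by rewrite /n; move: jk; rewrite add0n; lia.
apply/infixP; exists (tm_word 0 p), (tm_word (p + k.+1) (2 ^ (n.*2 + 3) - (p + k.+1))).
rewrite /tm_word -!map_cat; congr map.
rewrite -iotaD -[in X in _ = _ ++ X](add0n p) -iotaD; congr iota.
rewrite expnD /=; set M := (2 ^ n.*2)%N in n2 *.
rewrite /N -/M in pE; rewrite (_ : (2 ^ 3 = 8)%N)// /n in n2 *; lia.
Qed.

Lemma subshift_shift m (s : substitution m) x :
  subshift s x -> subshift s (shift_map x).
Proof.
move=> Xx i k; have [a [n H]] := Xx (i + 1) k; exists a, n.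
congr infix: H; apply: eq_map => j; rewrite /shift_map; congr x; lia.
Qed.

Lemma iter_shift m (x : fullshift m) (n : nat) (i : int) :
  iter n (@shift_map m) x i = x (i + n%:Z).
Proof.
elim: n i => [|n IH] i; first by rewrite addr0.
by rewrite iterS /shift_map IH; congr x; lia.
Qed.

Definition agree m (r : nat) (x y : fullshift m) : Prop :=
  forall i : int, (`|i| <= r)%N -> x i = y i.

Lemma nbhs_coordinate m (x : fullshift m) (i : int) :
  nbhs x [set y : fullshift m | y i = x i].
Proof.
apply: (@proj_continuous _ (fun _ : int => discrete_topology 'I_m) i x [set x i]).
exact: discrete_set1.
Qed.

Lemma nbhs_agree m (x : fullshift m) (r : nat) : nbhs x (agree r x).
Proof.
elim: r => [|r IH].
  apply: filterS (nbhs_coordinate x 0) => y y0 i.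
  by rewrite leqn0 absz_eq0 => /eqP ->.
near=> y => i; rewrite leq_eqVlt => /predU1P[ir|]; last first.
  by rewrite ltnS; apply: (near IH y).
have [->|->] : i = r.+1%:Z \/ i = - r.+1%:Z by lia.
  by apply/esym; near: y; exact: nbhs_coordinate.
by apply/esym; near: y; exact: nbhs_coordinate.
Unshelve. all: by end_near. Qed.

Section SlidingBlock.
Context {m n : nat} (s : substitution m).
Local Notation X := (subshift s).

Lemma subshift_agree_closed (x : fullshift m) :
  (forall r, exists2 y, X y & agree r x y) -> X x.
Proof.
move=> H i k; have [y Xy xy] := H (`|i| + k)%N.
have [a [l E]] := Xy i k; exists a, l; congr infix: E.
apply/eq_in_map => j; rewrite mem_iota => jk.
by apply/esym/xy; move: jk; rewrite add0n /=; lia.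
Qed.

Lemma compact_subshift : compact X.
Proof.
have cT : compact [set: fullshift m].
  rewrite (_ : [set: fullshift m] =
      [set f | forall i, [set: discrete_topology 'I_m] (f i)]).
    apply: (@tychonoff int (fun=> discrete_topology 'I_m) (fun=> setT)) => _.
    by apply: finite_compact; exact: finite_finset.
  by apply/seteqP; split.
apply: (subclosed_compact _ cT) => // x cx.
apply: subshift_agree_closed => r.
by have [y [Xy xy]] := cx _ (nbhs_agree x r); exists y.
Qed.

(** A point of the subshift other than [x] differs from [x] at some coordinate;
    compactness bounds the coordinates to inspect outside [U]. *)
Lemma nbhs_subshift_agree (x : fullshift m) (U : set (fullshift m)) :
  nbhs x U -> exists r, forall y, X y -> agree r x y -> U y.
Proof.
move=> Ux.
have /compact_near_coveringP/near_covering_withinP cX := compact_subshift.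
have : \forall r \near \oo, X `<=` (fun y => agree r x y -> U y).
  apply: cX => z Xz.
  have [->|zx] := pselect (z = x).
    by exists (U, setT) => [|[y r] [/= Uy _] _ _]; [split => //; exact: filterT|].
  have [i zi] : exists i, z i <> x i.
    apply/not_existsP => H; apply: zx; apply/funext => i.
    by have /contrapT := H i.
  exists ([set y | y i = z i], [set r | (`|i| <= r)%N]).
    by split; [exact: nbhs_coordinate|exact: nbhs_infty_ge].
  by case=> y r [/= yi ir] _ /(_ i ir); rewrite yi => /esym.
by case=> r _ H; exists r => y Xy; apply: H => //=.
Qed.

(** One direction of the Curtis-Hedlund-Lyndon theorem: continuity gives a radius
    at each point, and compactness a common one. *)
Lemma sliding_block (f : fullshift m -> fullshift n) :
  {within X, continuous f} ->
  exists r, forall x y, X x -> X y -> agree r x y -> f x 0 = f y 0.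
Proof.
move=> fc.
have /compact_near_coveringP/near_covering_withinP cX := compact_subshift.
have : \forall r \near \oo, X `<=`
    (fun x => forall y, X y -> agree r x y -> f x 0 = f y 0).
  apply: cX => x Xx.
  have : within X (nbhs x) [set y | f y 0 = f x 0].
    move/subspace_continuousP/(_ x Xx): fc => fcx.
    exact: (fcx _ (nbhs_coordinate (f x) 0)).
  move=> /nbhs_subshift_agree[r H].
  exists (agree r x, [set k | (r <= k)%N]).
    by split; [exact: nbhs_agree|exact: nbhs_infty_ge].
  case=> y k [/= xy rk] Xy z Xz yz.
  rewrite H// H// => i ir; rewrite (xy _ ir); apply: yz.
  exact: leq_trans rk.
by case=> r _ H; exists r => x y Xx; apply: (H r) => //=.
Qed.

End SlidingBlock.

(** The word starts inside some block, and is long enough to contain the next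
    one. *)
Lemma infix_block (T : eqType) (ss : seq (seq T)) (s : seq T) (B : nat) :
  (forall b, b \in ss -> size b <= B)%N -> (B.*2 < size s)%N ->
  infix s (flatten ss) -> exists2 b, b \in ss & infix b s.
Proof.
move=> + Bs /infixP[u [v]]; elim: ss u => [|b ss IH] u ssB E.
  by move/(congr1 size): E; rewrite /= !size_cat; lia.
have bB : (size b <= B)%N by apply: ssB; rewrite mem_head.
have ssB' b' : b' \in ss -> (size b' <= B)%N.
  by move=> b's; apply: ssB; rewrite inE b's orbT.
have [bu|ub] := leqP (size b) (size u).
  have [|c cs ?] := IH (drop (size b) u) ssB'.
    move/(congr1 (drop (size b))): E; rewrite /= drop_size_cat// => ->.
    by rewrite drop_cat; case: ltngtP bu => // ->; rewrite subnn drop0 drop_size.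
  by exists c => //; rewrite inE cs orbT.
have E' : flatten ss = drop (size b - size u) s ++ v.
  move/(congr1 (drop (size b))): E; rewrite /= drop_size_cat// => ->.
  rewrite drop_cat ltnNge (ltnW ub) /= drop_cat.
  by rewrite ifT//; lia.
case: ss {IH ssB E} ssB' E' => [|c ss] ssB' E'.
  by move/(congr1 size): E'; rewrite /= size_cat size_drop; lia.
exists c; first by rewrite !inE eqxx orbT.
have cB := ssB' c (mem_head _ _).
move/(congr1 (take (size c))): E'; rewrite /= take_size_cat// => ->.
rewrite take_cat ifT; last by rewrite size_drop; lia.
apply: (infix_trans (infix_take _ _)); exact: infix_drop.
Qed.

Lemma subst_mx_count m (s : substitution m) n (a b : 'I_m) :
  (subst_mx s ^+ n) a b = count_mem a (iter n (subst_ext s) [:: b]).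
Proof.
elim: n b => [|n IH] b; first by rewrite expr0 /= mxE addn0 eq_sym; case: eqP.
rewrite imageS image_flatten exprSr mxE count_flatten -map_comp sumnE big_map.
apply: etrans (esym (@sum_count _ nat (s b) _)).
by apply: eq_bigr => c _; rewrite IH /subst_mx mxE natn mulrC.
Qed.

Lemma primitive_mem m (s : substitution m) : primitive s ->
  exists n, forall a b, a \in iter n (subst_ext s) [:: b].
Proof.
case=> n _ H; exists n => a b; have := H a b.
by rewrite subst_mx_count -has_count has_pred1.
Qed.

(** A window longer than twice the images of level [n + p] contains a whole one,
    which in turn contains the image of level [n] of every letter, if [p] is an
    exponent given by primitivity. *)
Lemma subshift_contains m (s : substitution m) (y : fullshift m) :
  primitive s -> subshift s y -> forall n a, exists i : nat,
    forall j d, (j < size (iter n (subst_ext s) [:: a]))%N ->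
      nth d (iter n (subst_ext s) [:: a]) j = y (i + j)%N%:Z.
Proof.
move=> /primitive_mem[p pp] Xy n a; set q := (n + p)%N.
pose B := (\max_(j < q.+1) \max_(c < m) size (iter j (subst_ext s) [:: c]))%N.
have BP j c : (j <= q)%N -> (size (iter j (subst_ext s) [:: c]) <= B)%N.
  move=> jq; pose J := Ordinal (jq : (j < q.+1)%N).
  apply: leq_trans (leq_bigmax J).
  exact: (@leq_bigmax _ (fun c => size (iter J (subst_ext s) [:: c])) c).
have [c [k Hk]] := Xy 0 B.*2.
have qk : (q < k)%N.
  rewrite ltnNge; apply/negP => kq.
  have := leq_trans (size_infix Hk) (BP k c kq).
  by rewrite /window size_map size_iota; lia.
have := Hk; rewrite -(subnKC (ltnW qk)) iterD image_flatten.
move=> /(@infix_block _ _ _ B)[].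
- by move=> _ /mapP[d _ ->]; exact: BP.
- by rewrite size_map size_iota.
move=> _ /mapP[d _ ->]; rewrite /q iterD image_flatten => H.
have /infixP[u [v]] : infix (iter n (subst_ext s) [:: a]) (window y 0 B.*2).
  apply: infix_trans H; have /splitPr[w1 w2] := pp a d.
  rewrite map_cat flatten_cat /=; apply/infixP.
  by exists (flatten [seq iter n (subst_ext s) [:: b] | b <- w1]),
    (flatten [seq iter n (subst_ext s) [:: b] | b <- w2]).
move=> E; exists (size u) => j e je.
have uj : (size u + j <= B.*2)%N.
  move/(congr1 size): E; rewrite /window size_map size_iota !size_cat.
  by move: je; set t := size _; lia.
have := windowP E e uj; rewrite add0r => ->; rewrite nth_cat ltnNge leq_addr /= addKn.
by rewrite nth_cat je.
Qed.

Definition tm_local (T : Type) (L : nat) (f : nat -> T) : Prop :=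
  forall j k, (forall i, (i < L)%N -> tm (j + i) = tm (k + i)) -> f j = f k.

(** The word [sigma^n(a)] occurs in the image of a Thue-Morse point, hence is
    obtained by a sliding block code from a word of the sequence [tm]. The
    function [f b] is that code followed by the test for [b]. *)
Theorem factor_words m (s : substitution m) :
  primitive s -> topological_factor (subshift s) (subshift thue_morse) ->
  exists L (f : 'I_m -> nat -> bool), (forall b, tm_local L (f b)) /\
    forall n a, exists p, forall b j, (j < size (iter n (subst_ext s) [:: a]))%N ->
      (nth b (iter n (subst_ext s) [:: a]) j == b) = f b (p + j)%N.
Proof.
move=> ps [pi [pic piX piT]]; have [r rP] := sliding_block pic.
have [x Xx] := tm_subshift_nonempty.
have Xy : subshift s (pi x) by rewrite -piX; exists x.
pose fits (j : nat) (z : fullshift 2) :=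
  forall i, (i <= r.*2)%N -> z (i%:Z - r%:Z) = tm_letter (j + i).
pose f b j := `[< exists z, [/\ subshift thue_morse z, fits j z & pi z 0 = b] >].
exists r.*2.+1, f; split=> [b j k jk|n a].
  have fitsE z : fits j z <-> fits k z.
    by split=> H i ir; rewrite H// /tm_letter jk.
  apply/asboolP/asboolP => -[z [Xz zj zb]]; exists z; split => //; exact/fitsE.
have Tx (i : nat) : subshift thue_morse (iter i (@shift_map 2) x).
  by elim: i => //= i; exact: subshift_shift.
have piTx (i : nat) : pi x i%:Z = pi (iter i (@shift_map 2) x) 0.
  have -> : pi (iter i (@shift_map 2) x) = iter i (@shift_map m) (pi x).
    by elim: i => //= i <-; exact: piT.
  by rewrite iter_shift add0r.
have [i Hi] := subshift_contains ps Xy n a.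
set N := size _ in Hi *.
have [p Hp] := subshift_tm_word Xx (i%:Z - r%:Z) (N + r.*2).
exists p => b j jN; rewrite Hi// piTx.
have fit : fits (p + j)%N (iter (i + j) (@shift_map 2) x).
  move=> l lr; rewrite iter_shift -addnA -Hp; last by lia.
  by congr x; lia.
apply/eqP/asboolP => [<-|[z [Xz zf <-]]].
  by exists (iter (i + j) (@shift_map 2) x); split.
apply: rP => // l lr.
have [i' [li ir]] : exists i' : nat, l = i'%:Z - r%:Z /\ (i' <= r.*2)%N.
  by exists (absz (l + r%:Z)); lia.
by rewrite li fit// zf.
Qed.

(** * Exponential sums along the Thue-Morse sequence *)

Section WindowSums.
Context {R : realType}.
Implicit Types (f g : nat -> R[i]) (x e : R) (n p q : nat).

Definition wsum f x p q : R[i] := \sum_(p <= j < q) f j * e2pi (x *+ j).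

(** The number of terms is compared with a power of two because the recursion
    halves it. *)
Definition subexp f x : Prop := forall e, 0 < e -> exists C, forall n p q,
  (q <= p + 2 ^ n)%N -> normc (wsum f x p q) <= C * expR (e * n%:R).

Definition orbit_prod (w : R -> R) n x : R := \prod_(k < n) w (x *+ 2 ^ k).

Local Notation riesz := (orbit_prod chord).

(** The two properties of a frequency on which all estimates rest; both hold
    almost everywhere and pass from [x] to [2 x]. *)
Definition good x : Prop :=
  (forall e, 0 < e -> exists C, forall n, riesz n x <= C * expR (e * n%:R)) /\
  (forall e, 0 < e -> exists C, forall n,
     1 <= C * expR (e * n%:R) * chord (x *+ 2 ^ n)).

Lemma orbit_prod0 w x : orbit_prod w 0 x = 1.
Proof. exact: big_ord0. Qed.

Lemma orbit_prodS w n x : orbit_prod w n.+1 x = w x * orbit_prod w n (x *+ 2).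
Proof.
rewrite /orbit_prod big_ord_recl expn0 mulr1n; congr (_ * _).
by apply: eq_bigr => k _; rewrite /= /bump /= add1n expnS mulrnA.
Qed.

Lemma good_chord_gt0 x : good x -> 0 < chord x.
Proof.
case=> _ /(_ 1 ltr01)[C /(_ 0%N)]; rewrite lt0r chord_ge0 andbT.
by apply: contraTneq; rewrite expn0 mulr1n => ->; rewrite mulr0 ler10.
Qed.

Lemma good_double x : good x -> good (x *+ 2).
Proof.
move=> gx; have cx := good_chord_gt0 gx; case: gx => g1 g2; split => e e0.
  have [C HC] := g1 e e0; exists ((chord x)^-1 * (C * expR e)) => n.
  rewrite -mulrA ler_pdivlMl// -orbit_prodS (le_trans (HC _))//.
  by rewrite -mulrA -expRD -[n.+1]addn1 natrD mulrDr mulr1 addrC.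
have [C HC] := g2 e e0; exists (C * expR e) => n.
rewrite (le_trans (HC n.+1))// expnS mulrnA -[n.+1]addn1 natrD mulrDr mulr1 expRD.
by rewrite -!mulrA [expR _ * (expR e * _)]mulrCA.
Qed.

Lemma good_iter x n : good x -> good (x *+ 2 ^ n).
Proof.
by elim: n => [|n IH] gx; rewrite ?expn0// expnSr mulrnA; apply/good_double/IH.
Qed.

(** ** Stability of subexponential growth *)

Lemma subexpD f g x : subexp f x -> subexp g x -> subexp (f \+ g) x.
Proof.
move=> hf hg e e0; have [C HC] := hf e e0; have [D HD] := hg e e0.
exists (C + D) => n p q pq; rewrite mulrDl.
rewrite /wsum (_ : \sum_(_ <= _ < _) _ = wsum f x p q + wsum g x p q); last first.
  by rewrite /wsum -big_split; apply: eq_bigr => j _; rewrite mulrDl.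
by rewrite (le_trans (le_normcD _ _))// lerD// ?HC ?HD.
Qed.

Lemma wsumZ c f x p q : wsum (fun j => c * f j) x p q = c * wsum f x p q.
Proof. by rewrite /wsum mulr_sumr; apply: eq_bigr => j _; rewrite mulrA. Qed.

Lemma subexpZ c f x : subexp f x -> subexp (fun j => c * f j) x.
Proof.
move=> hf e e0; have [C HC] := hf e e0; exists (normc c * C) => n p q pq.
by rewrite wsumZ normcM -mulrA ler_wpM2l ?normc_ge0 ?HC.
Qed.

Lemma subexp_shift f x : subexp f x -> subexp (fun j => f j.+1) x.
Proof.
move=> hf e e0; have [C HC] := hf e e0; exists C => n p q pq.
have -> : wsum (fun j => f j.+1) x p q = e2pi (- x) * wsum f x p.+1 q.+1.
  rewrite /wsum big_add1 mulr_sumr; apply: eq_bigr => j _.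
  by rewrite mulrCA -e2piD mulrS addKr.
by rewrite normcM normc_e2pi mul1r HC.
Qed.

Lemma subexp_eq f g x : f =1 g -> subexp f x -> subexp g x.
Proof. by move=> /funext ->. Qed.

(** ** Splitting a sum according to the parity of the index *)

Lemma big_nat_double (V : nmodType) (F : nat -> V) p q :
  \sum_(p.*2 <= j < q.*2) F j = \sum_(p <= k < q) (F k.*2 + F k.*2.+1).
Proof.
have [qp|pq] := leqP q p; first by rewrite !big_geq// leq_double.
elim: q pq => // q IH; rewrite ltnS leq_eqVlt => /predU1P[->|pq].
  by rewrite doubleS big_nat1 big_ltn// big_nat1.
rewrite doubleS !big_nat_recr/= ?leq_double ?(ltnW pq)//; last first.
  by rewrite (@leq_trans q.*2)// leq_double ltnW.
by rewrite IH// addrA.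
Qed.

Definition refine f x : nat -> R[i] := fun k => f k.*2 + e2pi x * f k.*2.+1.

Lemma wsum_short f x B p q : (forall j, normc (f j) <= B) ->
  (q <= p.+1)%N -> normc (wsum f x p q) <= B.
Proof.
move=> fB; rewrite leq_eqVlt => /predU1P[->|].
  by rewrite /wsum big_nat1 normcM normc_e2pi mulr1.
rewrite ltnS => qp; rewrite /wsum big_geq// normc_zero.
exact: le_trans (normc_ge0 _) (fB 0%N).
Qed.

(** Adding the terms of index [2 k] and [2 k + 1] leaves out at most one term at
    each end. *)
Lemma wsum_refine f x B p q : (forall j, normc (f j) <= B) ->
  normc (wsum f x p q) <=
  2 * B + normc (wsum (refine f x) (x *+ 2) (uphalf p) q./2).
Proof.
move=> fB; have B0 : 0 <= B := le_trans (normc_ge0 _) (fB 0%N).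
have [pq|qp] := leqP (uphalf p) q./2; last first.
  rewrite (le_trans (wsum_short _ fB _))//; first by lia.
  by rewrite -[leLHS]addr0 lerD ?normc_ge0// mulr2n mulrDl mul1r lerDl.
have -> : wsum f x p q = wsum f x p (uphalf p).*2 +
    (wsum (refine f x) (x *+ 2) (uphalf p) q./2 + wsum f x q./2.*2 q).
  have -> : wsum (refine f x) (x *+ 2) (uphalf p) q./2 =
      wsum f x (uphalf p).*2 q./2.*2.
    rewrite /wsum big_nat_double; apply: eq_bigr => k _.
    rewrite /refine -mulrnA mul2n mulrDl [x *+ _.+1]mulrS e2piD; congr (_ + _).
    by rewrite [e2pi x * f _]mulrC mulrA.
  by rewrite /wsum -!big_cat_nat//; lia.
rewrite (le_trans (le_normcD _ _))// mulr2n mulrDl mul1r -addrA.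
rewrite lerD ?(wsum_short _ fB)//; first by lia.
rewrite (le_trans (le_normcD _ _))// addrC lerD// (wsum_short _ fB)//; lia.
Qed.

Lemma half_range n p q : (q <= p + 2 ^ n.+1)%N -> (q./2 <= uphalf p + 2 ^ n)%N.
Proof. by rewrite expnS; lia. Qed.

Lemma subexp_refine f x B : (forall j, normc (f j) <= B) ->
  subexp (refine f x) (x *+ 2) -> subexp f x.
Proof.
move=> fB hf e e0; have [C HC] := hf e e0.
have B0 : 0 <= B := le_trans (normc_ge0 _) (fB 0%N).
exists (2 * B + `|C|) => -[|n] p q pq.
  rewrite mulr0 expR0 mulr1 (le_trans (wsum_short _ fB _))// ?addn1// -1?addn1//.
  by rewrite -[leLHS]addr0 lerD// mulr2n mulrDl mul1r lerDl.
rewrite (le_trans (wsum_refine _ _ _ fB))// [leRHS]mulrDl lerD//.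
  by rewrite ler_peMr ?mulr_ge0// -expR0 ler_expR mulr_ge0// ltW.
rewrite (le_trans (HC n _ _ (half_range pq)))//.
rewrite (le_trans (ler_wpM2r (expR_ge0 _) (ler_norm C)))//.
by rewrite ler_wpM2l// ler_expR ler_pM2l// ler_nat.
Qed.

(** ** The four characters of words of length two *)

Lemma geometric_bound e : 0 < e -> exists K, forall n,
  \sum_(k < n.+1) expR (e * k%:R) <= K * expR (e * n%:R).
Proof.
move=> e0; have e1 : expR (- e) < 1 by rewrite expR_lt1 oppr_lt0.
exists (1 - expR (- e))^-1 => n; rewrite ler_pdivlMl ?subr_gt0//.
elim: n => [|n IH].
  by rewrite big_ord1 mulr0 expR0 mulr1 gerBl expR_ge0.
rewrite big_ord_recr mulrDr (le_trans (lerD IH (lexx _)))//.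
rewrite mulrBl mul1r -expRD.
have -> : - e + e * n.+1%:R = e * n%:R by rewrite -[n.+1]addn1 natrD; ring.
by rewrite addrC subrK.
Qed.

(** Since [n + 1] terms of size [expR (e * k%:R)] add up to a geometric sum,
    iterating the recursion costs nothing in the exponent. *)
Lemma subexp_sum_bound f x (a : nat -> R) :
  (forall e, 0 < e -> exists C, forall n, a n <= C * expR (e * n%:R)) ->
  (forall n p q, (q <= p + 2 ^ n)%N ->
     normc (wsum f x p q) <= \sum_(k < n.+1) a k) ->
  subexp f x.
Proof.
move=> ha hf e e0; have [C HC] := ha e e0; have [K HK] := geometric_bound e0.
exists (`|C| * K) => n p q pq; rewrite (le_trans (hf _ _ _ pq))//.
rewrite -mulrA (le_trans _ (ler_wpM2l (normr_ge0 C) (HK n)))// mulr_sumr.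
apply: ler_sum => k _; rewrite (le_trans (HC k))//.
by rewrite ler_wpM2r ?expR_ge0 ?ler_norm.
Qed.

Lemma wsum_one x p q : chord x * normc (wsum (fun=> 1) x p q) <= 2.
Proof.
rewrite /chord -normcM /wsum.
have [qp|/ltnW pq] := leqP q p.
  by rewrite big_geq// mulr0 normc_zero.
suff -> : (1 - e2pi x) * (\sum_(p <= j < q) 1 * e2pi (x *+ j)) =
    e2pi (x *+ p) - e2pi (x *+ q).
  by rewrite (le_trans (le_normcD _ _))// normcN !normc_e2pi.
elim: q pq => [|q IH]; first by rewrite leqn0 => /eqP->; rewrite big_geq// mulr0 subrr.
rewrite leq_eqVlt => /predU1P[<-|]; first by rewrite big_geq// mulr0 subrr.
rewrite ltnS => pq; rewrite big_nat_recr//= mulrDr IH// mul1r mulrSr e2piD.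
by ring.
Qed.

Lemma subexp_one x : good x -> subexp (fun=> 1) x.
Proof.
move=> /good_chord_gt0 cx e e0; exists (2 / chord x) => n p q _.
have h : normc (wsum (fun=> 1) x p q) <= 2 / chord x.
  by rewrite ler_pdivlMr// mulrC wsum_one.
rewrite (le_trans h)// ler_peMr ?divr_ge0 ?chord_ge0//.
by rewrite -expR0 ler_expR mulr_ge0// ltW.
Qed.

Definition chi (j : nat) : R[i] := (-1) ^+ tm j.

Lemma chi_double j : chi j.*2 = chi j.
Proof. by rewrite /chi tm_double. Qed.

Lemma chi_doubleS j : chi j.*2.+1 = - chi j.
Proof. by rewrite /chi tm_doubleS; case: tm; rewrite ?opprK. Qed.

Lemma normc_chi j : normc (chi j) = 1.
Proof. by rewrite /chi; case: tm; rewrite ?normcN normc_one. Qed.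

Lemma sqr_chi j : chi j * chi j = 1.
Proof. by rewrite /chi; case: tm; rewrite ?mulrNN mulr1. Qed.

(** Adding the terms [2 k] and [2 k + 1] multiplies the sum by [1 - e2pi x], which
    produces the Riesz products. *)
Lemma subexp_chi x : good x -> subexp chi x.
Proof.
move=> gx; apply: (@subexp_sum_bound _ _ (fun k => 2 * riesz k x)).
  move=> e e0; have [C HC] := gx.1 e e0; exists (2 * C) => n.
  by rewrite -mulrA ler_pM2l.
move=> n {gx}; elim: n x => [|n IH] x p q pq.
  rewrite big_ord1 orbit_prod0 mulr1 (le_trans (@wsum_short _ _ 1 _ _ _ _))//.
  - by move=> j; rewrite normc_chi.
  - by rewrite -addn1.
  - by rewrite ler1n.
rewrite big_ord_recl orbit_prod0.
rewrite (le_trans (@wsum_refine _ _ 1 _ _ _))//; first by move=> j; rewrite normc_chi.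
rewrite lerD//.
have -> : refine chi x = (fun k => (1 - e2pi x) * chi k).
  by apply/funext => k; rewrite /refine chi_double chi_doubleS; ring.
rewrite wsumZ normcM.
under eq_bigr do rewrite /= /bump /= add1n orbit_prodS mulrCA.
by rewrite -mulr_sumr ler_wpM2l ?chord_ge0// IH// half_range.
Qed.

Definition chi2 j := chi j * chi j.+1.

Lemma normc_chi2 j : normc (chi2 j) = 1.
Proof. by rewrite normcM !normc_chi mulr1. Qed.

Lemma refine_chi2 x : refine chi2 x = (fun k => - 1 + - e2pi x * chi2 k).
Proof.
apply/funext => k; rewrite /refine /chi2 -doubleS !chi_double chi_doubleS.
by rewrite [chi k * - _]mulrN sqr_chi; ring.
Qed.

(** At each step a constant function and the same character come back; the
    constants contribute inverse chords. *)
Lemma subexp_chi2 x : good x -> subexp chi2 x.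
Proof.
move=> gx; have := gx => -[_ g2].
apply: (@subexp_sum_bound _ _ (fun k => 2 + 2 / chord (x *+ 2 ^ k.+1))).
  move=> e e0; have [C HC] := g2 e e0; exists (2 + 2 * (C * expR e)) => n.
  rewrite [leRHS]mulrDl lerD//.
    by rewrite ler_peMr// -expR0 ler_expR mulr_ge0// ltW.
  rewrite -!mulrA ler_pM2l// -expRD -[leLHS]mul1r ler_pdivrMr; last first.
    exact/good_chord_gt0/good_iter.
  have -> : e + e * n%:R = e * n.+1%:R by rewrite -[n.+1]addn1 natrD; ring.
  exact: HC.
move=> {g2} n; elim: n x gx => [|n IH] x gx p q pq.
  rewrite big_ord1 (le_trans (@wsum_short _ _ 1 _ _ _ _))//.
  - by move=> j; rewrite normc_chi2.
  - by rewrite -addn1.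
  - by rewrite -[leLHS]addr0 lerD ?ler1n// divr_ge0 ?chord_ge0.
rewrite (le_trans (@wsum_refine _ _ 1 _ _ _))//; first by move=> j; rewrite normc_chi2.
rewrite big_ord_recl mulr1 expn1 -[leRHS]addrA lerD// refine_chi2.
set y := x *+ 2; have gy : good y := good_double gx.
have -> : wsum (fun k => -1 + - e2pi x * chi2 k) y (uphalf p) q./2 =
    -1 * wsum (fun=> 1) y (uphalf p) q./2 + - e2pi x * wsum chi2 y (uphalf p) q./2.
  by rewrite -!wsumZ /wsum -big_split; apply: eq_bigr => j _; rewrite /=; ring.
rewrite (le_trans (le_normcD _ _))// !normcM !normcN normc_one normc_e2pi !mul1r.
rewrite lerD//.
  by rewrite ler_pdivlMr ?good_chord_gt0// mulrC wsum_one.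
rewrite (le_trans (IH y gy _ _ (half_range pq)))//.
apply: ler_sum => k _ /=; rewrite /bump /= add1n.
by rewrite /y -mulrnA -expnS.
Qed.

(** ** Functions of finite windows *)

(** Expansion in the four characters of pairs of letters. The pairs 00, 01, 10 and
    11 are read at the positions 5, 0, 2 and 1 of the sequence. *)
Lemma local2_subexp f x : tm_local 2 f -> good x -> subexp f x.
Proof.
move=> lf gx; pose a := f 5%N; pose b := f 0%N; pose c := f 2%N; pose d := f 1%N.
apply: (@subexp_eq (((fun=> (a + b + c + d) / 4 * 1)
  \+ (fun j => (a + b - c - d) / 4 * chi j))
  \+ ((fun j => (a - b + c - d) / 4 * chi j.+1)
  \+ (fun j => (a - b - c + d) / 4 * chi2 j)))).
  have fE j k : tm j = tm k -> tm j.+1 = tm k.+1 -> f j = f k.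
    move=> e0 e1; apply: lf => -[|[|]]// _; rewrite ?addn0 ?addn1//.
  move=> j; rewrite /= /chi2 /chi.
  case E0 : (tm j); case E1 : (tm j.+1).
  - by rewrite (fE j 1%N)// /a /b /c /d; field.
  - by rewrite (fE j 2%N)// /a /b /c /d; field.
  - by rewrite (fE j 0%N)// /a /b /c /d; field.
  - by rewrite (fE j 5%N)// /a /b /c /d; field.
apply: subexpD; apply: subexpD; apply: subexpZ.
- exact: subexp_one.
- exact: subexp_chi.
- exact/(@subexp_shift chi)/subexp_chi.
- exact: subexp_chi2.
Qed.

(** Desubstitution roughly halves the width of a window, so every window
    function is reduced to windows of length two. *)
Theorem local_subexp L f x B : tm_local L f -> (forall j, normc (f j) <= B) ->
  good x -> subexp f x.
Proof.
have [l] := ubnP L; elim: l L f x B => // l IH L f x B Ll lf fB gx.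
have [L2|L2] := leqP L 2.
  by apply: local2_subexp => // j k H; apply: lf => i iL; apply: H; lia.
apply: (subexp_refine fB).
apply: (IH L./2.+1 _ _ (2 * B)); first by lia.
- move=> j k H; rewrite /refine; congr (_ + _ * _); apply: lf => i iL.
    rewrite tmE [RHS]tmE !oddD !odd_double; congr (_ (+) _).
    have -> : ((j.*2 + i)./2 = j + i./2)%N by lia.
    have -> : ((k.*2 + i)./2 = k + i./2)%N by lia.
    by apply: H; lia.
  rewrite tmE [RHS]tmE; congr (_ (+) _); first by rewrite !oddD /= !odd_double.
  have -> : ((j.*2.+1 + i)./2 = j + i.+1./2)%N by lia.
  have -> : ((k.*2.+1 + i)./2 = k + i.+1./2)%N by lia.
  by apply: H; lia.
- move=> j; rewrite mulr2n mulrDl mul1r (le_trans (le_normcD _ _))//.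
  by rewrite normcM normc_e2pi mul1r lerD.
- exact: good_double.
Qed.

End WindowSums.

(** * Almost every frequency is good *)

Section AlmostEvery.
Context {R : realType}.
Implicit Types (x e : R) (n k : nat).

(** Borel-Cantelli for sets covered by finitely many balls of equal radius;
    working with covers avoids all measurability questions. *)
Lemma ae_eventually_not (E : nat -> set R) (s : nat -> seq R) (d : nat -> R) (C r : R) :
  0 <= r < 1 -> 0 <= C ->
  (forall n x, E n x -> exists2 c, c \in s n & `|c - x| < d n) ->
  (forall n, 0 <= d n) ->
  (forall n, (size (s n))%:R * (d n *+ 2) <= C * r ^+ n) ->
  \forall x \ae (@lebesgue_measure R), exists N, forall n, (N <= n)%N -> ~ E n x.
Proof.
move=> /andP[r0 r1] C0 Ecov d0 dC.
pose F n : set R := \big[setU/set0]_(c <- s n) ball c (d n).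
have mF n : measurable (F n).
  by apply: bigsetU_measurable => c _; exact: measurable_ball.
have muF n : (lebesgue_measure (F n) <= (C * r ^+ n)%:E)%E.
  apply: le_trans (_ : (((size (s n))%:R * (d n *+ 2))%:E <= _)%E); last first.
    by rewrite lee_fin.
  rewrite /F; elim: (s n) => [|c t IH]; first by rewrite big_nil measure0 mul0r.
  rewrite big_cons /= -natr1 mulrDl mul1r addrC EFinD.
  apply: le_trans (measureU2 _ _ _) _.
  - exact: measurable_ball.
  - by apply: bigsetU_measurable => c' _; exact: measurable_ball.
  - by apply: leeD IH; rewrite -(lebesgue_measure_ball c (d0 n)).
have sumF : (\sum_(0 <= n <oo) lebesgue_measure (F n) < +oo)%E.
  apply: (@le_lt_trans _ _ (C / (1 - r))%:E); last exact: ltry.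
  apply: lime_le; first exact: is_cvg_nneseries.
  apply: nearW => n; apply: (@le_trans _ _ (\sum_(0 <= k < n) (C * r ^+ k)%:E)%E).
    exact: lee_sum.
  rewrite sumEFin lee_fin -mulr_sumr ler_wpM2l// -[leRHS]mul1r.
  rewrite ler_pdivlMr ?subr_gt0// big_mkord -opprB mulrN mulrC -subrX1 opprB.
  by rewrite gerBl exprn_ge0.
exists (lim_sup_set F); split.
- by apply: bigcap_measurable => // k _; apply: bigcup_measurable => j _; exact: mF.
- exact: lim_sup_set_cvg0.
move=> x /= nx N _; apply: contrapT => HN; apply: nx; exists N => n Nn Ex; apply: HN.
exists n => //; have [c cs xc] := Ecov n x Ex.
rewrite /F; elim: (s n) cs => // c' t IH; rewrite inE big_cons => /predU1P[<-|/IH].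
  by left.
by right.
Qed.

Lemma ae_impl (P Q : R -> Prop) : (forall x, P x -> Q x) ->
  (\forall x \ae (@lebesgue_measure R), P x) ->
  \forall x \ae (@lebesgue_measure R), Q x.
Proof.
have F : Filter (almost_everywhere (@lebesgue_measure R)).
  exact: ae_filter_ringOfSetsType.
exact: filterS.
Qed.

Lemma ae_impl2 (P Q S : R -> Prop) : (forall x, P x -> Q x -> S x) ->
  (\forall x \ae (@lebesgue_measure R), P x) ->
  (\forall x \ae (@lebesgue_measure R), Q x) ->
  \forall x \ae (@lebesgue_measure R), S x.
Proof.
have F : Filter (almost_everywhere (@lebesgue_measure R)).
  exact: ae_filter_ringOfSetsType.
exact: filterS2.
Qed.

(** A union bound over the zeros of [chord (x *+ N n)] in the unit interval: there
    are about [N n] of them, but their neighbourhoods have radius inversely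
    proportional to [N n]. *)
Lemma ae_chord_eventually (N : nat -> nat) e : (forall n, 0 < N n)%N -> 0 < e ->
  \forall x \ae (@lebesgue_measure R), x \in `[0, 1[ ->
    exists M, forall n, (M <= n)%N -> expR (- e) ^+ n <= chord (x *+ N n).
Proof.
move=> N0 e0; have [k k0 Hk] := @chord_ge R.
have r0 : 0 < expR (- e) by exact: expR_gt0.
have r1 : expR (- e) < 1 by rewrite expR_lt1 oppr_lt0.
have Nr n : 0 < (N n)%:R :> R by rewrite ltr0n.
pose E n : set R := [set x | (x \in `[0, 1[) /\ chord (x *+ N n) < expR (- e) ^+ n].
pose s n : seq R := [seq l%:R / (N n)%:R | l <- iota 0 (N n).+2].
pose d n : R := expR (- e) ^+ n / k / (N n)%:R.
suff : \forall x \ae (@lebesgue_measure R), exists M, forall n, (M <= n)%N -> ~ E n x.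
  apply: ae_impl => x [M HM] x01; exists M => n /HM nE.
  by rewrite leNgt; apply/negP => lt; apply: nE.
apply: (@ae_eventually_not E s d (6 / k) (expR (- e))).
- by rewrite ltW.
- by rewrite divr_ge0 ?ltW.
- move=> n x [+ xE]; rewrite in_itv /= => /andP[x0 x1].
  have y0 : 0 <= x *+ N n by rewrite mulrn_wge0.
  have [l ly kl] := Hk _ y0.
  have lN : (l < (N n).+2)%N.
    have xN : x *+ N n < (N n)%:R by rewrite -[x *+ _]mulr_natr gtr_pMl.
    by rewrite -(ltr_nat R) (le_lt_trans ly)// -[in ltRHS]addn2 natrD; lra.
  exists (l%:R / (N n)%:R); first by apply/mapP; exists l; rewrite ?mem_iota.
  have dist : `|l%:R / (N n)%:R - x| * (N n)%:R = `|x *+ N n - l%:R|.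
    rewrite -[X in _ * X](gtr0_norm (Nr n)) -normrM mulrBl divfK ?gt_eqF//.
    by rewrite mulr_natr distrC.
  rewrite /d ltr_pdivlMr// dist ltr_pdivlMr// mulrC.
  exact: le_lt_trans xE.
- by move=> n; rewrite !divr_ge0 ?exprn_ge0 ?ltW.
- move=> n; rewrite size_map size_iota -[d n *+ 2]mulr_natr /d.
  have n3 : (N n).+2%:R <= 3 * (N n)%:R :> R.
    by rewrite -natrM ler_nat; have := N0 n; lia.
  have -> : 6 / k * expR (- e) ^+ n =
      3 * (N n)%:R * (expR (- e) ^+ n / k / (N n)%:R * 2).
    by field; rewrite !gt_eqF.
  by rewrite ler_wpM2r// !mulr_ge0 ?invr_ge0 ?exprn_ge0 ?ltW.
Qed.

(** A family of conditions monotone in [e] reduces to the countable one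
    [e = 1 / (k + 1)]. *)
Lemma ae_scales (P : R -> R -> Prop) :
  (forall x e e', e <= e' -> P e x -> P e' x) ->
  (forall e, 0 < e -> \forall x \ae (@lebesgue_measure R), P e x) ->
  \forall x \ae (@lebesgue_measure R), forall e, 0 < e -> P e x.
Proof.
move=> Pmono Pae.
have : \forall x \ae (@lebesgue_measure R), forall k : nat, P k.+1%:R^-1 x.
  by apply: ae_foralln => k; apply: Pae; rewrite invr_gt0.
apply: ae_impl => x Px e e0; apply: Pmono (Px (Num.truncn e^-1)).
rewrite invf_ple ?posrE// ltW// ; exact: truncnS_gt.
Qed.

Lemma ae_chord_lower (N : nat -> nat) : (forall n, 0 < N n)%N ->
  \forall x \ae (@lebesgue_measure R), x \in `[0, 1[ ->
    forall e, 0 < e -> exists C, forall n, 1 <= C * expR (e * n%:R) * chord (x *+ N n).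
Proof.
move=> N0.
(* A constant sequence of integers shows that a single chord does not vanish,
   which takes care of the finitely many indices left out by [ev]. *)
have pos : \forall x \ae (@lebesgue_measure R), forall n,
    x \in `[0, 1[ -> 0 < chord (x *+ N n).
  apply: ae_foralln => n.
  apply: ae_impl (@ae_chord_eventually (fun=> N n) 1 (fun=> N0 n) ltr01).
  move=> x H /H[M HM].
  by apply: lt_le_trans (HM M (leqnn M)); rewrite exprn_gt0 ?expR_gt0.
have ev : \forall x \ae (@lebesgue_measure R), forall e, 0 < e -> x \in `[0, 1[ ->
    exists M, forall n, (M <= n)%N -> expR (- e) ^+ n <= chord (x *+ N n).
  apply: ae_scales => [x e e' ee' H /H[M HM]|e e0]; last exact: ae_chord_eventually.
  exists M => n /HM; apply: le_trans.
  by rewrite lerXn2r ?nnegrE ?expR_ge0// ler_expR lerN2.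
apply: ae_impl2 pos ev => x xpos xev x01 e e0.
have [M HM] := xev e e0 x01.
exists (1 + \sum_(n < M) (chord (x *+ N n))^-1) => n.
have S0 : 0 <= \sum_(n < M) (chord (x *+ N n))^-1.
  by apply: sumr_ge0 => i _; rewrite invr_ge0 chord_ge0.
have en : 1 <= expR (e * n%:R) by rewrite -expR0 ler_expR mulr_ge0// ltW.
have [Mn|nM] := leqP M n.
  apply: (@le_trans _ _ (expR (e * n%:R) * expR (- e) ^+ n)).
    by rewrite -expRM_natr -expRD mulNr subrr expR0.
  rewrite ler_pM ?expR_ge0 ?exprn_ge0 ?expR_ge0 ?HM//.
  by rewrite ler_peMl ?expR_ge0// lerDl.
rewrite mulrAC (le_trans _ (ler_peMr _ en))//; last first.
  by rewrite mulr_ge0 ?chord_ge0// addr_ge0.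
rewrite mulrDl (bigD1 (Ordinal nM))//= mulrDl mulVf ?gt_eqF ?xpos//.
rewrite addrCA lerDl addr_ge0// ?mulr_ge0 ?chord_ge0//.
by apply: sumr_ge0 => i _; rewrite invr_ge0 chord_ge0.
Qed.

End AlmostEvery.

(** * Typical growth of the Riesz products *)

Section RieszGrowth.
Context {R : realType}.
Implicit Types (x y e s : R) (n k : nat).

Local Notation riesz := (orbit_prod (@chord R)).

Lemma riesz_ge0 n x : 0 <= riesz n x.
Proof. by apply: prodr_ge0 => k _; exact: chord_ge0. Qed.

Lemma riesz_le n x : riesz n x <= 2 ^+ n.
Proof.
rewrite -[in leRHS](card_ord n) -prodr_const; apply: ler_prod => k _.
by rewrite chord_ge0 chord_le2.
Qed.

Lemma rieszSr n x : riesz n.+1 x = riesz n x * chord (x *+ 2 ^ n).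
Proof. exact: big_ord_recr. Qed.

(** All factors are at most [2], and the [k]-th one has slope at most
    [2 * pi * 2 ^ k]. *)
Lemma riesz_lip n x y : riesz n x <= riesz n y + 4 ^+ n * (2 * pi) * `|x - y|.
Proof.
elim: n => [|n IH]; first by rewrite !orbit_prod0 lerDl !mulr_ge0// pi_ge0.
set D := 2 * pi * `|x - y|; have D0 : 0 <= D by rewrite !mulr_ge0// pi_ge0.
have lip : chord (x *+ 2 ^ n) <= chord (y *+ 2 ^ n) + 2 ^+ n * D.
  rewrite (le_trans (chord_lip _ (y *+ 2 ^ n)))// lerD2l -mulrnBl normrMn.
  by rewrite -[`|_| *+ _]mulr_natl natrX mulrCA.
rewrite !rieszSr -mulrA -/D; rewrite -mulrA -/D in IH.
apply: (le_trans (ler_wpM2l (riesz_ge0 _ _) lip)); rewrite mulrDr.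
have h1 : riesz n x * (2 ^+ n * D) <= 4 ^+ n * D.
  have -> : 4 ^+ n = 2 ^+ n * 2 ^+ n :> R by rewrite -exprMn -natrM.
  by rewrite mulrA ler_wpM2r// ler_wpM2r ?exprn_ge0// riesz_le.
have h2 : riesz n x * chord (y *+ 2 ^ n) <=
    riesz n y * chord (y *+ 2 ^ n) + 2 * (4 ^+ n * D).
  apply: (le_trans (ler_wpM2r (chord_ge0 _) IH)); rewrite mulrDl lerD2l mulrC.
  by rewrite ler_wpM2r ?chord_le2// mulr_ge0// exprn_ge0.
apply: (le_trans (lerD h2 h1)); rewrite exprS -addrA lerD2l.
have : 0 <= 4 ^+ n * D by rewrite mulr_ge0// exprn_ge0.
by rewrite -mulrA; set q := 4 ^+ n * D; lra.
Qed.

Lemma expR_le_quad (t : R) : t <= 2^-1 -> expR t <= 1 + t + 2 * t ^+ 2.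
Proof.
move=> t2; have t1 : 0 < 1 - t by lra.
rewrite -(ler_pM2r t1); apply: (@le_trans _ _ 1).
  by rewrite -[leRHS](expRxMexpNx_1 t) ler_wpM2l ?expR_ge0// expR_ge1Dx.
rewrite -subr_ge0 (_ : _ - 1 = t ^+ 2 * (1 - 2 * t)); last by ring.
by rewrite mulr_ge0 ?sqr_ge0//; lra.
Qed.

Section Transfer.
Variable w : R -> R.
Hypothesis w_ge0 : forall x, 0 <= w x.
Hypothesis w_periodic : forall x, w (x + 1) = w x.

Lemma w_periodicn x n : w (x + n%:R) = w x.
Proof. by elim: n => [|n IH]; rewrite ?addr0// -natr1 addrA w_periodic. Qed.

Lemma orbit_prod_periodic n x : orbit_prod w n (x + 1) = orbit_prod w n x.
Proof. by apply: eq_bigr => k _; rewrite mulrnDl w_periodicn. Qed.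

Lemma orbit_prod_ge0 n x : 0 <= orbit_prod w n x.
Proof. by apply: prodr_ge0. Qed.

(** The transfer operator of the doubling map, on dyadic grids: summing over
    the two preimages [x] and [x + 1/2] of [2 x] costs a factor [2 c]. *)
Lemma orbit_prod_average c M n : 0 <= c ->
  (forall x, w x + w (x + 2^-1) <= 2 * c) -> (n <= M)%N ->
  \sum_(0 <= j < 2 ^ M) orbit_prod w n (j%:R / 2 ^+ M) <= 2 ^+ M * c ^+ n.
Proof.
move=> c0 wc; elim: n M => [|n IH] M nM.
  under eq_bigr do rewrite orbit_prod0.
  by rewrite sumr_const_nat subn0 natrX expr0 mulr1.
case: M nM => // M; rewrite ltnS => nM.
rewrite expnS mul2n -addnn (big_cat_nat (n := (2 ^ M)%N)) ?leq_addr//=.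
rewrite -{2}[(2 ^ M)%N]add0n big_addn addnK -big_split /=.
have -> : 2 ^+ M.+1 * c ^+ n.+1 = 2 * c * (2 ^+ M * c ^+ n) by rewrite !exprS; ring.
apply: le_trans (ler_wpM2l _ (IH M nM)); last by rewrite mulr_ge0.
rewrite mulr_sumr; apply: ler_sum => j _.
have M0 : 2 ^+ M != 0 :> R by rewrite expf_neq0.
have -> : (j + 2 ^ M)%:R / 2 ^+ M.+1 = j%:R / 2 ^+ M.+1 + 2^-1 :> R.
  by rewrite natrD natrX exprS; field; rewrite M0.
have E : (j%:R / 2 ^+ M.+1) *+ 2 = j%:R / 2 ^+ M :> R.
  by rewrite exprS -mulr_natr; field; rewrite M0.
rewrite !orbit_prodS mulrnDl -[2^-1 *+ 2]mulr_natr mulVf// orbit_prod_periodic E.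
by rewrite -mulrDl ler_wpM2r ?orbit_prod_ge0.
Qed.

End Transfer.

(** ** A weight dominating the chord *)

Section Weight.
Variable d : R.
Hypotheses (d0 : 0 < d) (d1 : d <= 1).

(** The chord times the coboundary of [log (chord x + d)]. For [d = 0] the values
    at [x] and [x + 2^-1] would be inverse to each other by [chord_double], but
    unbounded. *)
Definition alpha x : R := chord x * (chord x + d) / (chord (x *+ 2) + d).

Lemma chordD_gt0 x : 0 < chord x + d.
Proof. by rewrite ltr_wpDl ?chord_ge0. Qed.

Lemma alpha_ge0 x : 0 <= alpha x.
Proof. by rewrite divr_ge0 ?mulr_ge0 ?chord_ge0// ltW// chordD_gt0. Qed.

Lemma alpha_le x : alpha x <= 6 / d.
Proof.
have c2 := chord_le2 x; have c0 := chord_ge0 x; have [d0' d1'] := (d0, d1).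
apply: ler_pM.
- by rewrite mulr_ge0// ltW// chordD_gt0.
- by rewrite invr_ge0 ltW// chordD_gt0.
- have -> : 6 = 2 * 3 :> R by rewrite -natrM.
  by apply: ler_pM => //; lra.
- by rewrite lef_pV2 ?posrE ?chordD_gt0// lerDr chord_ge0.
Qed.

(** With [u] and [v] the two chords and [p = u * v] the chord of [2 x], the point is
    [p * (u + v - 2) <= p ^+ 2], that is [(u - 1) * (v - 1) >= -1]. *)
Lemma alpha_half x : alpha x * alpha (x + 2^-1) <= 1 + d + d ^+ 2.
Proof.
rewrite /alpha mulrnDl -[2^-1 *+ 2]mulr_natr mulVf//.
rewrite -[1]/(1%:R) chordDn -[x *+ 2]mulr_natl chord_double.
have := chord_le2 x; have := chord_ge0 x.
have := chord_le2 (x + 2^-1); have := chord_ge0 (x + 2^-1).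
set u := chord x; set v := chord _ => v0 v2 u0 u2.
have p0 : 0 <= u * v by rewrite mulr_ge0.
have pd : 0 < u * v + d by rewrite ltr_wpDl.
rewrite mulrACA -invfM ler_pdivrMr ?mulr_gt0//.
have uv : u + v - 2 <= u * v.
  have : 0 <= (2 - u) * v + u * (2 - v) by rewrite addr_ge0// mulr_ge0// subr_ge0.
  nra.
have h := ler_wpM2l p0 uv.
rewrite -subr_ge0.
set rhs := _ - _.
have -> : rhs = d * (u * v * (u * v) - u * v * (u + v - 2))
   + d ^+ 2 * (u * v) ^+ 2 + d ^+ 2 * (u * v) + 2 * d ^+ 3 * (u * v)
   + d ^+ 2 + d ^+ 3 + d ^+ 4.
  rewrite /rhs; ring.
have d0' : 0 <= d := ltW d0.
have dn k : 0 <= d ^+ k by rewrite exprn_ge0.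
do !apply: addr_ge0; rewrite ?dn//; do !apply: mulr_ge0 => //; rewrite ?exprn_ge0//.
by rewrite subr_ge0.
Qed.

Lemma alpha_periodic x : alpha (x + 1) = alpha x.
Proof.
by rewrite /alpha mulrnDl -[1]/(1%:R) -mulrnA !chordDn.
Qed.

Lemma riesz_alpha n x :
  riesz n x * (chord x + d) = orbit_prod alpha n x * (chord (x *+ 2 ^ n) + d).
Proof.
elim: n x => [|n IH] x; first by rewrite orbit_prod0 orbit_prod0 expn0.
rewrite orbit_prodS orbit_prodS expnS mulrnA -[RHS]mulrA -IH /alpha.
by field; rewrite gt_eqF// chordD_gt0.
Qed.

Lemma riesz_le_alpha n x : riesz n x <= 3 / d * orbit_prod alpha n x.
Proof.
rewrite mulrAC ler_pdivlMr//.
apply: (@le_trans _ _ (riesz n x * (chord x + d))).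
  by rewrite ler_wpM2l ?riesz_ge0// lerDr chord_ge0.
rewrite riesz_alpha mulrC ler_wpM2r ?orbit_prod_ge0//; first exact: alpha_ge0.
by have := chord_le2 (x *+ 2 ^ n); have := d1; lra.
Qed.

End Weight.

(** Here [h] is the logarithm of [alpha], floored so as to be bounded by some [H]
    without increasing the product of its values at [x] and [x + 2^-1] beyond
    [expR e]. Then [h x + h (x + 2^-1) <= e] bounds the first order term of
    the exponential moment, and a small [s] makes the second order term,
    of size [(s * H) ^+ 2], negligible. *)
Lemma riesz_weight e : 0 < e -> exists (h : R -> R) (K s : R),
  [/\ 0 < s, 0 < K, forall x, h (x + 1) = h x,
      forall x, expR (s * h x) + expR (s * h (x + 2^-1)) <= 2 * expR (s * e)
    & forall n x, riesz n x <= K * expR (\sum_(k < n) h (x *+ 2 ^ k))].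
Proof.
move=> e0; pose d := Num.min 1 (e / 2).
have d0 : 0 < d by rewrite lt_min ltr01 divr_gt0.
have d1 : d <= 1 by rewrite ge_min lexx.
have de : 1 + d + d ^+ 2 <= expR e.
  have de2 : d <= e / 2 by rewrite ge_min lexx orbT.
  have dd : d ^+ 2 <= d by rewrite expr2 ler_piMr// ltW.
  by apply: le_trans (expR_ge1Dx e); lra.
pose B := 6 / d + expR e.
have B6 : 6 <= 6 / d by rewrite ler_pdivlMr// ler_piMr.
have E0 := expR_gt0 e.
have B1 : 1 <= B by rewrite /B; lra.
have B0 : 0 < B by lra.
have BE : expR e <= B by rewrite /B; lra.
(* [B] bounds [alpha], so the floor [expR e / B] is harmless in a product. *)
pose f x := Num.max (alpha d x) (expR e / B).
have f0 x : 0 < f x by rewrite lt_max; apply/orP; right; exact: divr_gt0.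
have fB x : f x <= B.
  rewrite ge_max (le_trans (alpha_le d0 d1 x)) /=; last by rewrite /B; lra.
  by rewrite ler_pdivrMr// (le_trans BE)// ler_peMl// ltW.
have ff x : f x * f (x + 2^-1) <= expR e.
  have aE y : alpha d y * (expR e / B) <= expR e.
    rewrite mulrCA ler_piMr ?(ltW E0)// ler_pdivrMr// mul1r.
    by rewrite (le_trans (alpha_le d0 d1 y))// /B lerDl ltW.
  have EE : expR e / B * (expR e / B) <= expR e.
    rewrite -[leRHS]mulr1 -mulrA ler_pM2l// mulrCA -invfM ler_pdivrMr ?mulr_gt0//.
    by rewrite mul1r (le_trans BE)// ler_peMl// ltW.
  rewrite /f; case: (leP (alpha d x)) => _; case: (leP (alpha d (x + _))) => _ //.
    by rewrite mulrC.
  by rewrite (le_trans (alpha_half d0 x)).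
pose h x := ln (f x); pose H := 1 + ln B.
have lB : 0 <= ln B by exact: ln_ge0.
have H1 : 1 <= H by rewrite lerDl.
have hH x : `|h x| <= H.
  have h1 : h x <= ln B by rewrite ler_ln ?posrE.
  have h2 : - ln B <= h x.
    rewrite -lnV ?posrE// ler_ln ?posrE ?invr_gt0// le_max; apply/orP; right.
    by rewrite -[leLHS]mul1r ler_wpM2r ?invr_ge0 ?(ltW B0)// -expR0 ler_expR ltW.
  by rewrite ler_norml /H; apply/andP; split; lra.
have hh x : h x + h (x + 2^-1) <= e.
  by rewrite -lnM ?posrE// -[leRHS]expRK ler_ln ?posrE ?mulr_gt0.
pose s := Num.min (2^-1) (e / 4) / H ^+ 2.
have H2 : 0 < H ^+ 2 by rewrite exprn_gt0//; lra.
have s0 : 0 < s by rewrite divr_gt0// lt_min invr_gt0 ltr0n divr_gt0.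
have sH : s * H ^+ 2 = Num.min (2^-1) (e / 4) by rewrite divfK ?gt_eqF.
have sH1 : s * H ^+ 2 <= 2^-1 by rewrite sH ge_min lexx.
have sH2 : s * H ^+ 2 <= e / 4 by rewrite sH ge_min lexx orbT.
have HH : H <= H ^+ 2 by rewrite expr2 ler_peMl//; lra.
have quad x : expR (s * h x) <= 1 + s * h x + 2 * s * (s * H ^+ 2).
  have := hH x; rewrite ler_norml => /andP[hl hu].
  have sh : s * h x <= 2^-1.
    by rewrite (le_trans _ sH1)// ler_pM2l// (le_trans hu).
  rewrite (le_trans (expR_le_quad sh))// lerD2l exprMn -mulrA ler_pM2l//.
  rewrite [leRHS]mulrA -expr2 ler_pM2l ?exprn_gt0//.
  by rewrite -(real_normK (num_real (h x))) lerXn2r// nnegrE; lra.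
exists h, (3 / d), s; split => //.
- by rewrite divr_gt0.
- by move=> x; rewrite /h /f alpha_periodic.
- move=> x; apply: (le_trans (lerD (quad x) (quad _))).
  apply: (@le_trans _ _ (2 * (1 + s * e))); last by rewrite ler_pM2l// expR_ge1Dx.
  have := ler_wpM2l (ltW s0) (hh x); rewrite mulrDr => A1.
  have := ler_wpM2l (ltW s0) sH2 => A2.
  have arith (a u v q : R) : u + v <= a * e -> a * q <= a * (e / 4) ->
      1 + u + 2 * a * q + (1 + v + 2 * a * q) <= 2 * (1 + a * e).
    by move=> *; lra.
  exact: arith.
- move=> n x; rewrite (le_trans (riesz_le_alpha d0 d1 n x))// ler_pM2l ?divr_gt0//.
  rewrite expR_sum; apply: ler_prod => k _.
  by rewrite alpha_ge0//= lnK ?posrE// le_max lexx.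
Qed.

Lemma count_le (T : Type) (r : seq T) (P : pred T) (F : T -> R) c :
  (forall j, 0 <= F j) -> (forall j, P j -> c <= F j) ->
  (size [seq j <- r | P j])%:R * c <= \sum_(j <- r) F j.
Proof.
move=> F0 PF; elim: r => [|j r IH] /=; first by rewrite big_nil mul0r.
rewrite big_cons; case: ifP => [/PF cF|_] /=.
  by rewrite -natr1 mulrDl mul1r addrC lerD.
by rewrite (le_trans IH)// lerDr.
Qed.

(** Markov's inequality on a dyadic grid fine enough for the Riesz product to be
    almost constant on its cells. *)
Lemma ae_riesz_eventually e : 0 < e ->
  \forall x \ae (@lebesgue_measure R), x \in `[0, 1[ ->
    exists C, forall n, riesz n x <= C * expR (e * n%:R).
Proof.
move=> e0; have e20 : 0 < e / 2 by rewrite divr_gt0.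
have [h [K [s [s0 K0 hper hc hK]]]] := riesz_weight e20.
pose w x := expR (s * h x).
(* Cells so small that [riesz_lip] changes the product by less than [1]. *)
pose grid n : R := 2 ^+ (n.*2 + 3).
have g0 n : 0 < grid n by rewrite exprn_gt0.
pose E n : set R := [set x | (x \in `[0, 1[) /\ K * expR (e * n%:R) + 1 < riesz n x].
pose P n (y : R) := K * expR (e * n%:R) < riesz n y.
pose t n : seq R := [seq j%:R / grid n |
  j <- index_iota 0 (2 ^ (n.*2 + 3)) & P n (j%:R / grid n)].
pose r := expR (- (s * (e / 2))).
suff : \forall x \ae (@lebesgue_measure R), exists N, forall n, (N <= n)%N -> ~ E n x.
  apply: ae_impl => x [N HN] x01.
  exists (K + 1 + 2 ^+ N) => n.
  have en : 1 <= expR (e * n%:R) by rewrite -expR0 ler_expR mulr_ge0// ltW.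
  have [Nn|nN] := leqP N n.
    have : riesz n x <= K * expR (e * n%:R) + 1.
      by rewrite leNgt; apply/negP => lt; apply: (HN n Nn).
    move/le_trans; apply; rewrite -addrA mulrDl lerD2l mulrDl mul1r.
    by rewrite (le_trans en)// lerDl mulr_ge0 ?exprn_ge0 ?expR_ge0.
  rewrite (le_trans (riesz_le n x))// (le_trans _ (ler_peMr _ en))//; last first.
    by rewrite !addr_ge0 ?exprn_ge0 ?ltW.
  rewrite (@le_trans _ _ (2 ^+ N))// ?ler_weXn2l ?ler1n ?(ltnW nN)//.
  by rewrite lerDr addr_ge0 ?ltW.
apply: (@ae_eventually_not _ E t (fun n => (grid n)^-1) 2 r) => //.
- by rewrite expR_ge0 /= expR_lt1 oppr_lt0 mulr_gt0.
- move=> n x [+ xE]; rewrite in_itv /= => /andP[x0 x1].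
  pose j := Num.truncn (x * grid n).
  have /andP[j1 j2] : j%:R <= x * grid n < j.+1%:R.
    by apply: truncn_itv; rewrite mulr_ge0// ltW.
  have dist : `|j%:R / grid n - x| < (grid n)^-1.
    rewrite distrC ger0_norm; last by rewrite subr_ge0 ler_pdivrMr.
    rewrite ltrBlDr -[X in X + _]mul1r -mulrDl ltr_pdivlMr// (lt_le_trans j2)//.
    by rewrite addrC natr1.
  exists (j%:R / grid n) => //; apply/mapP; exists j => //.
  rewrite mem_filter mem_index_iota /=; apply/andP; split; last first.
    by rewrite -(ltr_nat R) natrX (le_lt_trans j1)// gtr_pMl.
  rewrite /P -(ltrD2r 1) (lt_le_trans xE)//.
  rewrite (le_trans (riesz_lip n x (j%:R / grid n)))//.
  rewrite lerD2l distrC.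
  apply: (@le_trans _ _ (4 ^+ n * (2 * pi) * (grid n)^-1)).
    apply: ler_wpM2l; last exact: ltW.
    by rewrite mulr_ge0 ?exprn_ge0// mulr_ge0// pi_ge0.
  have -> : grid n = 4 ^+ n * 8.
    by rewrite /grid exprD -mul2n exprM; congr (_ ^+ _ * _); rewrite -natrX.
  rewrite ler_pdivrMr ?mulr_gt0 ?exprn_gt0// mul1r ler_wpM2l ?exprn_ge0//.
  by have := @pihalf_lt2 R; lra.
- by move=> n; rewrite invr_ge0 ltW.
- move=> n; rewrite size_map.
  have avg : \sum_(0 <= j < 2 ^ (n.*2 + 3)) orbit_prod w n (j%:R / grid n) <=
      grid n * expR (s * (e / 2)) ^+ n.
    apply: orbit_prod_average => [x|x|||].
    - exact: expR_ge0.
    - by rewrite /w hper.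
    - exact: expR_ge0.
    - exact: hc.
    - by rewrite -addnn -addnA leq_addr.
  have bE x : orbit_prod w n x = expR (s * \sum_(k < n) h (x *+ 2 ^ k)).
    by rewrite mulr_sumr expR_sum.
  have PF j : P n (j%:R / grid n) ->
      expR (s * (e * n%:R)) <= orbit_prod w n (j%:R / grid n).
    rewrite /P => /lt_le_trans/(_ (hK n _)); rewrite ltr_pM2l// ltr_expR => lt.
    by rewrite bE ler_expR ler_pM2l// ltW.
  have := count_le (index_iota 0 (2 ^ (n.*2 + 3)))
    (fun j => orbit_prod_ge0 (fun x => expR_ge0 (s * h x)) n (j%:R / grid n)) PF.
  move=> /le_trans/(_ avg); set sz := size _ => H.
  have -> : sz%:R * ((grid n)^-1 *+ 2) = 2 * (sz%:R / grid n).
    by rewrite -[_ *+ 2]mulr_natl mulrCA.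
  rewrite ler_pM2l// ler_pdivrMr// -(ler_pM2r (expR_gt0 (s * (e * n%:R)))).
  rewrite (le_trans H)// [leRHS]mulrAC [leLHS]mulrC ler_wpM2r ?(ltW (g0 n))//.
  rewrite /r -!expRM_natr -expRD ler_expR le_eqVlt.
  by apply/orP; left; apply/eqP; field.
Qed.

Theorem ae_good :
  \forall x \ae (@lebesgue_measure R), x \in `[0, 1[ -> good x.
Proof.
have g1 : \forall x \ae (@lebesgue_measure R), forall e, 0 < e -> x \in `[0, 1[ ->
    exists C, forall n, riesz n x <= C * expR (e * n%:R).
  apply: ae_scales => [x e e' ee' H /H[C HC]|e e0]; last exact: ae_riesz_eventually.
  exists `|C| => n; rewrite (le_trans (HC n))//.
  rewrite (le_trans (ler_wpM2r (expR_ge0 _) (ler_norm C)))//.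
  by rewrite ler_wpM2l// ler_expR ler_wpM2r.
have g2 := @ae_chord_lower R (fun n => 2 ^ n)%N (fun n => expn_gt0 2 n).
apply: ae_impl2 g1 g2 => x h1 h2 x01; split; last exact: h2.
by move=> e e0; exact: h1.
Qed.

End RieszGrowth.

(** * The Lyapunov exponent *)

Section Norm.
Context {R : realType}.

Lemma Re_le (z w : R[i]) : z <= w -> complex.Re z <= complex.Re w.
Proof. by rewrite lecE => /andP[]. Qed.

Lemma normc_le_mx_norm m n (A : 'M[R[i]]_(m, n)) i j :
  normc (A i j) <= complex.Re (mx_norm A).
Proof.
suff : `|A i j| <= mx_norm A by move/Re_le; rewrite normc_def; case: (A i j).
rewrite mx_normE -[leLHS]nngE num_le.
exact: (le_bigmax _ (fun ij : 'I_m * 'I_n => `|A ij.1 ij.2|%:nng) (i, j)).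
Qed.

Lemma mx_norm_le m n (A : 'M[R[i]]_(m, n)) (B : R) : 0 <= B ->
  (forall i j, normc (A i j) <= B) -> complex.Re (mx_norm A) <= B.
Proof.
move=> B0 AB; have [->//|/mx_norm_neq0[ij ->]] := eqVneq (mx_norm A) 0.
by rewrite normc_def; apply: le_trans (AB ij.1 ij.2); case: (A _ _).
Qed.

Lemma subexponential_exponent (M : nat -> R) :
  (forall e, 0 < e -> exists C, forall n, M n <= C * expR (e * n%:R)) ->
  (forall e, 0 < e -> exists C, forall n, 1 <= C * expR (e * n%:R) * M n) ->
  (forall n, 0 <= M n) ->
  limn_esup (fun n => ((n%:R)^-1)%:E * lne (M n)%:E)%E = 0%E :> \bar R.
Proof.
move=> up low M0.
have Mgt0 n : 0 < M n.
  have [C /(_ n)] := low 1 ltr01; rewrite lt0r M0 andbT.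
  by apply: contraTneq => ->; rewrite mulr0 ler10.
have -> : (fun n => ((n%:R)^-1)%:E * lne (M n)%:E)%E =
    EFin \o (fun n => n%:R^-1 * ln (M n)) :> (nat -> \bar R).
  by apply/funext => n; rewrite lne_EFin.
suff : (fun n => n%:R^-1 * ln (M n)) @ \oo --> (0 : R).
  move=> v0.
  have [] := @cvg_limn_einf_sup R (EFin \o (fun n => n%:R^-1 * ln (M n))) 0%E.
    by apply: cvg_EFin v0; exact: nearW.
  by [].
apply/cvgrPdist_le => e e0; have e20 : 0 < e / 2 by rewrite divr_gt0.
have [C1 H1] := up _ e20; have [C2 H2] := low _ e20.
pose D := `|ln C1| + `|ln C2|.
near=> n; rewrite sub0r normrN normrM normfV.
have n0 : 0 < n%:R :> R by rewrite ltr0n; near: n; exact: nbhs_infty_gt.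
have Dn : D / (e / 2) <= n%:R by near: n; exact: nbhs_infty_ger.
rewrite (ger0_norm (ltW n0)) ler_pdivrMl//.
rewrite ler_pdivrMr// in Dn.
have C1gt : 0 < C1 by have := lt_le_trans (Mgt0 n) (H1 n); rewrite pmulr_lgt0 ?expR_gt0.
have C2gt : 0 < C2.
  by have := lt_le_trans ltr01 (H2 n); rewrite pmulr_lgt0// pmulr_lgt0 ?expR_gt0.
have h1 : ln (M n) <= ln C1 + e / 2 * n%:R.
  rewrite -[X in _ + X]expRK -lnM ?posrE ?expR_gt0// ler_ln ?posrE//.
  by rewrite mulr_gt0 ?expR_gt0.
have h2 : 0 <= ln C2 + e / 2 * n%:R + ln (M n).
  rewrite -[X in _ + X + _]expRK -!lnM ?posrE ?mulr_gt0 ?expR_gt0//.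
  exact: ln_ge0.
have := ler_norm (ln C1); have := ler_norm (ln C2).
rewrite /D in Dn; move: (normr_ge0 (ln C1)) (normr_ge0 (ln C2)) Dn h1 h2.
rewrite ler_norml.
set a := `|ln C1|; set b := `|ln C2|; move=> *; apply/andP; split; lra.
Unshelve. all: by end_near. Qed.

End Norm.

Section Growth.
Context {m : nat} (sigma : substitution m).

Lemma size_subst_ext_le D (w : seq 'I_m) : (forall a, size (sigma a) <= D)%N ->
  (size (subst_ext sigma w) <= D * size w)%N.
Proof.
move=> sD; rewrite /subst_ext size_flatten /shape -map_comp sumnE big_map.
elim: w => [|a w IH]; first by rewrite big_nil.
by rewrite big_cons /= mulnS leq_add.
Qed.

Lemma size_image_le : exists k, forall n a,
  (size (iter n (subst_ext sigma) [:: a]) <= 2 ^ (k * n))%N.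
Proof.
pose k := (\max_(a < m) size (sigma a))%N; exists k => n a.
elim: n => [|n IH]; first by rewrite muln0.
rewrite iterS (leq_trans (@size_subst_ext_le k _ _))//.
  by move=> c; exact: (leq_bigmax (F := fun c => size (sigma c))).
rewrite mulnS expnD leq_mul// ltnW// ltn_expl//.
Qed.

End Growth.

(** A translation of the positions only changes the phase. *)
Lemma letter_sum_wsum (R : realType) m (x : R) (b : 'I_m) w p (f : nat -> bool) :
  (forall j, (j < size w)%N -> (nth b w j == b) = f (p + j)%N) ->
  normc (letter_sum x b w) =
  normc (wsum (fun j => (f j)%:R) x p (p + size w)).
Proof.
move=> H.
have -> : wsum (fun j => (f j)%:R) x p (p + size w) =
    e2pi (x *+ p) * letter_sum x b w.
  rewrite /wsum -{1}[p]add0n big_addn addKn /letter_sum mulr_sumr.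
  apply: eq_big_nat => j jw; rewrite H// addnC mulrnDr e2piD.
  by rewrite mulrCA.
by rewrite normcM normc_e2pi mul1r.
Qed.

Theorem corollary1p3 (R : realType) (m : nat) (sigma : substitution m) :
  (1 < m)%N ->
  primitive sigma ->
  aperiodic sigma ->
  topological_factor (subshift sigma) (subshift thue_morse) ->
  \forall omega \ae (@lebesgue_measure R),
    omega \in `[0, 1[ -> lyapunov sigma omega = 0%E.
Proof.
move=> m1 prim _ fact.
have [L [f [floc words]]] := factor_words prim fact.
pose a0 : 'I_m := Ordinal (ltnW m1).
pose W n a := iter n (subst_ext sigma) [:: a].
have low := @ae_chord_lower R (fun n => size (W n a0))
  (fun n => @size_image_gt0 _ sigma n [:: a0] isT).
apply: ae_impl2 (@ae_good R) low => x good_x lower_x x01.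
have gx := good_x x01; have {}lower_x := lower_x x01.
apply: subexponential_exponent => [e e0|e e0|n].
- have [k Wk] := size_image_le sigma.
  have sub b : subexp (fun j => (f b j)%:R) x.
    apply: (@local_subexp _ L _ _ 1) => //.
      by move=> i j ij; rewrite (floc b i j ij).
    by move=> j; case: (f b j); rewrite ?normc_zero ?normc_one.
  (* The words have at most [2 ^ (k * n)] letters. *)
  have ek : 0 < e / k.+1%:R by rewrite divr_gt0.
  have /choice[C HC] := fun b => sub b _ ek.
  exists (\sum_b `|C b|) => n; apply: mx_norm_le => [|a b].
    by rewrite mulr_ge0 ?expR_ge0// sumr_ge0.
  have [p Hp] := words n a.
  rewrite cocycle_letter_sum (letter_sum_wsum x (Hp b)).
  rewrite (le_trans (HC b (k * n)%N _ _ _))//; first by rewrite leq_add2l Wk.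
  rewrite (le_trans (ler_wpM2r (expR_ge0 _) (ler_norm (C b))))// ler_pM ?expR_ge0//.
    by rewrite (bigD1 b)//= lerDl sumr_ge0.
  rewrite ler_expR -mulrA ler_pM2l// ler_pdivrMl// -natrM ler_nat.
  by rewrite leq_mul2r leqnSn orbT.
- have [C HC] := lower_x e e0; exists (`|C| * (2 * m%:R)) => n.
  set N := complex.Re _.
  have N0 : 0 <= N by rewrite (le_trans _ (@normc_le_mx_norm R _ _ _ a0 a0)) ?normc_ge0.
  have cN : chord (x *+ size (W n a0)) <= 2 * m%:R * N.
    rewrite /chord -sum_letter_sum normcM -mulrA ler_pM ?normc_ge0 ?chord_le2//.
    rewrite (le_trans (normc_sum _ _ _))//.
    rewrite -[m in m%:R]card_ord -sum1_card natr_sum mulr_suml.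
    apply: ler_sum => b _; rewrite mul1r -cocycle_letter_sum.
    exact: normc_le_mx_norm.
  have -> : `|C| * (2 * m%:R) * expR (e * n%:R) * N =
      `|C| * expR (e * n%:R) * (2 * m%:R * N) by ring.
  apply: (le_trans (HC n)); apply: (le_trans _ (ler_wpM2l _ cN)).
    by rewrite !ler_wpM2r ?chord_ge0 ?expR_ge0 ?ler_norm.
  by rewrite mulr_ge0 ?expR_ge0.
- by rewrite (le_trans _ (@normc_le_mx_norm R _ _ _ a0 a0)) ?normc_ge0.
Qed.
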